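(* Let $N$ be a positive integer. There is a multiplicative character $\epsilon:\tilde\Gamma\to\mu_{12}\subseteq\mathbb C^\times$ such that $\tilde\gamma^*({}_N\Theta)=\epsilon(\tilde\gamma)\cdot{}_N\Theta$ for all $\tilde\gamma\in\tilde\Gamma$. Moreover, for $\mathbf x\in\mathbb Z^2$, $T=\begin{pmatrix}1&1\\0&1\end{pmatrix}$ and $S=\begin{pmatrix}0&1\\-1&0\end{pmatrix}$, $$\epsilon(\mathbf x,1)=1,\quad\epsilon(0,T)=e^{2\pi i(N^2-1)/12},\quad\epsilon(0,S)=i^{N^2-1}.$$
   Context: On $\tilde{\mathfrak H}=\mathbb C\times\mathfrak H$ define $\Theta(u,\tau)=q^{1/12}(t^{1/2}-t^{-1/2})\prod_{n\ge1}(1-q^nt)(1-q^nt^{-1})$ with $t=e^{2\pi iu}$, $q=e^{2\pi i\tau}$ (with $q^{1/12}=e^{2\pi i\tau/12}$, $t^{1/2}=e^{\pi iu}$), and ${}_N\Theta(u,\tau)=\Theta(u,\tau)^{N^2}/\Theta(Nu,\tau)$, a meromorphic function. Let $\tilde G=\mathbb R^2\rtimes\operatorname{GL}_2^+(\mathbb R)$ ($\mathbb R^2$ row vectors) with product $(\mathbf x_1,\gamma_1)(\mathbf x_2,\gamma_2)=(\mathbf x_1+\mathbf x_2\gamma_1^{-1},\gamma_1\gamma_2)$, acting on $\tilde{\mathfrak H}$ on the left by $(\mathbf x,\gamma)\cdot(u,\tau)=\bigl(\frac{u+\rho_{\mathbf x\gamma}(\tau)}{c\tau+d},\gamma\tau\bigr)$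 where $\gamma=\begin{pmatrix}a&b\\c&d\end{pmatrix}$ and $\rho_{(x_1,x_2)}(\tau)=x_1\tau+x_2$; pullback $\tilde\gamma^*f(u,\tau)=f(\tilde\gamma\cdot(u,\tau))$. $\tilde\Gamma=\mathbb Z^2\rtimes\operatorname{SL}_2(\mathbb Z)$. *)

(* Defs.v *)
From Stdlib Require Import Reals ZArith.
From Coquelicot Require Import Coquelicot.

Local Open Scope C_scope.

Definition Cexp (z : C) : C :=
  (exp (Re z) * cos (Im z), exp (Re z) * sin (Im z))%R.

(* Componentwise, in the style of Coquelicot's [C_lim]; meaningful when
   both components converge to finite limits, as is the case for the product
   defining [Theta] on [upper]. *)
Definition Clim_seq (u : nat -> C) : C :=
  (real (Lim_seq (fun n => Re (u n))), real (Lim_seq (fun n => Im (u n)))).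

Fixpoint Cprod (f : nat -> C) (m : nat) : C :=
  match m with
  | O => 1
  | S k => Cprod f k * f (S k)
  end.

Definition infprod (f : nat -> C) : C := Clim_seq (Cprod f).

(* Points (u, tau); the space C x H is the subset [upper]. *)
Definition upper (p : C * C) : Prop := (0 < Im (snd p))%R.

Definition Theta (p : C * C) : C :=
  let (u, tau) := p in
  let q := Cexp (2 * PI * Ci * tau) in
  let t := Cexp (2 * PI * Ci * u) in
  let t_half := Cexp (PI * Ci * u) in
  Cexp (2 * PI * Ci * tau / 12) * (t_half - / t_half)
  * infprod (fun n => (1 - q ^ n * t) * (1 - q ^ n * / t)).

(* A meromorphic function on C x H, given as a quotient, is handled as a
   partial function: [pval] is only significant on [pdom], the set where the
   denominator does not vanish.  This avoids the convention [/ 0 = 0]; the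
   omitted points are a nowhere dense analytic set, so equality as partial
   functions entails equality as meromorphic functions. *)
Record pfun : Type := PFun { pdom : C * C -> Prop; pval : C * C -> C }.

Definition pfun_eq (f g : pfun) : Prop :=
  forall p : C * C, upper p ->
    (pdom f p <-> pdom g p) /\ (pdom f p -> pval f p = pval g p).

Definition pscale (c : C) (f : pfun) : pfun :=
  PFun (pdom f) (fun p => c * pval f p).

Definition NTheta (N : nat) : pfun :=
  let den := fun p : C * C => Theta (INR N * fst p, snd p) in
  PFun (fun p => den p <> 0) (fun p => Theta p ^ (N ^ 2) / den p).

Definition ent {m n : nat} (A : @matrix R m n) (i j : nat) : R :=
  coeff_mat 0%R A i j.

Definition mat2 (a b c d : R) : @matrix R 2 2 := [[a, b], [c, d]].
Definition row2 (x1 x2 : R) : @matrix R 1 2 := [[x1, x2]].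

Definition det2 (g : @matrix R 2 2) : R :=
  (ent g 0 0 * ent g 1 1 - ent g 0 1 * ent g 1 0)%R.

Definition inv2 (g : @matrix R 2 2) : @matrix R 2 2 :=
  mat2 (ent g 1 1 / det2 g) (- ent g 0 1 / det2 g)
       (- ent g 1 0 / det2 g) (ent g 0 0 / det2 g).

(* Carrier of R^2 x| GL_2^+(R), which is the subset [0 < det2 (snd g)]. *)
Definition Gt : Type := (@matrix R 1 2 * @matrix R 2 2)%type.

Definition gmul (g1 g2 : Gt) : Gt :=
  (Mplus (fst g1) (Mmult (T := R_Ring) (fst g2) (inv2 (snd g1))),
   Mmult (T := R_Ring) (snd g1) (snd g2)).

Definition rho (x : @matrix R 1 2) (tau : C) : C :=
  ent x 0 0 * tau + ent x 0 1.

Definition act (g : Gt) (p : C * C) : C * C :=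
  let (x, gam) := g in
  let (u, tau) := p in
  let num := ent gam 0 0 * tau + ent gam 0 1 in
  let den := ent gam 1 0 * tau + ent gam 1 1 in
  ((u + rho (Mmult (T := R_Ring) x gam) tau) / den, num / den).

Definition pullback (g : Gt) (f : pfun) : pfun :=
  PFun (fun p => pdom f (act g p)) (fun p => pval f (act g p)).

Definition integral {m n : nat} (A : @matrix R m n) : Prop :=
  forall i j : nat, exists z : Z, ent A i j = IZR z.

(* Z^2 x| SL_2(Z) as a subset of [Gt] *)
Definition Gammat (g : Gt) : Prop :=
  integral (fst g) /\ integral (snd g) /\ det2 (snd g) = 1%R.

(* Only the values of [eps] on [Gammat] matter. *)
Definition is_mu12_character (eps : Gt -> C) : Prop :=
  (forall g, Gammat g -> eps g ^ 12 = 1) /\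
  (forall g h, Gammat g -> Gammat h -> eps (gmul g h) = eps g * eps h).

Definition I2 : @matrix R 2 2 := mat2 1 0 0 1.
Definition Tmat : @matrix R 2 2 := mat2 1 1 0 1.
Definition Smat : @matrix R 2 2 := mat2 0 1 (-1) 0.

(* Main.v *)
(* Write Theta(u,tau) = q^(1/12) (t^(1/2) - t^(-1/2)) E(t) E(1/t) with the Euler
   product E(x) = prod_(n>=1) (1 - q^n x) = (1 - qx) E(qx), which gives the
   behaviour under u -> u+1, u -> u+tau and tau -> tau+1.

   For tau -> -1/tau, both Theta(u,tau) and Theta(u/tau,-1/tau) exp(-pi i u^2/tau)
   have, after multiplication by exp(pi i u), period 1 and the multiplier
   -exp(-2 pi i u) under u -> u+tau.  Such functions form a line: the
   discrete Fourier coefficients of order M of g are, up to factors independent of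
   g, the means of g over u + k tau + j/M, and as M grows these means become
   independent of the base point.  Hence
   Theta(u/tau,-1/tau) = c exp(pi i u^2/tau) Theta(u,tau) with c independent of u.
   Multiplying this over u = 1/2, tau/2, (1+tau)/2 gives c^3 = i, since the product
   of the values of Theta there is explicit by Euler's identity; multiplying over
   u = 1/3, tau/3, (1+tau)/3, (2+tau)/3 gives c^4 = 1.  So c = -i.

   The factors for Theta(u)^(N^2) and Theta(Nu) then cancel up to a constant,
   the Euclidean algorithm extends this to SL_2(Z), and uniqueness of
   the constant makes it a character. *)
Require Import Defs.
From Stdlib Require Import Reals ZArith Lra Lia ClassicalEpsilon.
From Coquelicot Require Import Coquelicot.
Local Open Scope C_scope.

(** * Complex exponential and convergence *)

(** The obstacle is to compare two functions of $u$ with the same quasi-periods without contour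
    integrals. Such a function is determined by its zeroth Fourier coefficient, because the $k$-th
    one is a mean based at $u+k\tau$; that the base point does not matter, usually Cauchy's theorem,
    comes here from bounds on second divided differences. The means are not shown to converge. It is
    enough that all frequencies share one mean up to a vanishing error, since the two functions are
    compared by cross-multiplication.

    Up to a constant, Theta is the odd Jacobi theta function divided by the eta function, so $c$
    usually comes from the transformation of eta. Torsion values replace it: $u\mapsto u/\tau$
    permutes the torsion points of order 2, and those of order 3, up to sign and lattice
    translation, and the product of the values of Theta over them is a constant times a power of
    $q$. Neither order alone determines $c$, but together they give $c=c^4/c^3$. *)

Lemma Cexp_plus (a b : C) : Cexp (a + b) = Cexp a * Cexp b.
Proof.
  destruct a as [a1 a2], b as [b1 b2]; unfold Cexp; simpl.
  rewrite exp_plus, cos_plus, sin_plus.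
  apply injective_projections; simpl; ring.
Qed.

Lemma Cexp_0 : Cexp 0 = 1.
Proof.
  unfold Cexp; simpl; rewrite exp_0, cos_0, sin_0.
  apply injective_projections; simpl; ring.
Qed.

Lemma Cmod_Cexp (z : C) : Cmod (Cexp z) = exp (Re z).
Proof.
  unfold Cmod, Cexp; simpl.
  replace (_ + _)%R with ((exp (Re z))^2 * (Rsqr (sin (Im z)) + Rsqr (cos (Im z))))%R
    by (unfold Rsqr; ring).
  rewrite sin2_cos2, Rmult_1_r, <- Rsqr_pow2.
  apply sqrt_Rsqr, Rlt_le, exp_pos.
Qed.

Lemma Cexp_neq_0 (z : C) : Cexp z <> 0.
Proof.
  apply Cmod_gt_0; rewrite Cmod_Cexp; apply exp_pos.
Qed.

Lemma Cexp_opp (z : C) : Cexp (- z) = / Cexp z.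
Proof.
  rewrite <- (Cmult_1_l (/ Cexp z)), <- Cexp_0.
  replace (RtoC 0) with (z + - z) by ring.
  rewrite Cexp_plus; field; apply Cexp_neq_0.
Qed.

Lemma Cexp_pow (z : C) (n : nat) : Cexp z ^ n = Cexp (INR n * z).
Proof.
  induction n as [|n IH].
  - simpl; rewrite Cmult_0_l, Cexp_0; reflexivity.
  - rewrite Cpow_S, IH, <- Cexp_plus, S_INR, RtoC_plus; f_equal; ring.
Qed.

Lemma Cexp_Im (y : R) : Cexp (Ci * y) = (cos y, sin y).
Proof.
  unfold Cexp; simpl.
  replace (0 * y - 1 * 0)%R with 0%R by ring.
  replace (0 * 0 + 1 * y)%R with y by ring.
  rewrite exp_0; apply injective_projections; simpl; ring.
Qed.

Lemma Cexp_PI : Cexp (PI * Ci) = - (1).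
Proof.
  rewrite Cmult_comm, Cexp_Im, cos_PI, sin_PI.
  apply injective_projections; simpl; ring.
Qed.

Lemma Cexp_PI2 : Cexp (PI * Ci / 2) = Ci.
Proof.
  replace (PI * Ci / 2) with (Ci * (PI / 2)%R)
    by (rewrite RtoC_div by lra; field).
  rewrite Cexp_Im, cos_PI2, sin_PI2; reflexivity.
Qed.

Lemma Cexp_2PI_INR (n : nat) : Cexp (INR n * (2 * (PI * Ci))) = 1.
Proof.
  rewrite <- Cexp_pow.
  replace (2 * (PI * Ci)) with (PI * Ci + PI * Ci) by ring.
  rewrite Cexp_plus, Cexp_PI.
  replace (- (1) * - (1)) with (RtoC 1) by ring.
  apply Cpow_1_l.
Qed.

Lemma Cexp_2PI_IZR (k : Z) : Cexp (IZR k * (2 * (PI * Ci))) = 1.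
Proof.
  destruct (Z_le_gt_dec 0 k) as [H | H].
  - rewrite <- (Z2Nat.id k) at 1 by lia.
    rewrite <- INR_IZR_INZ; apply Cexp_2PI_INR.
  - replace (IZR k * (2 * (PI * Ci))) with (- (INR (Z.to_nat (- k)) * (2 * (PI * Ci)))).
    + rewrite Cexp_opp, Cexp_2PI_INR; field.
    + rewrite INR_IZR_INZ, Z2Nat.id by lia.
      rewrite opp_IZR, RtoC_opp; ring.
Qed.

(** Stated through the real sequence of moduli, so that squeezing and the algebra of real limits
    apply; [Ccv_Clim_seq] leads back to the componentwise [Clim_seq]. *)
Definition Ccv (u : nat -> C) (l : C) : Prop :=
  is_lim_seq (fun n => Cmod (u n - l)) 0.

Lemma is_lim_seq_squeeze_0 (u e : nat -> R) :
  (forall n, 0 <= u n <= e n)%R -> is_lim_seq e 0 -> is_lim_seq u 0.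
Proof.
  intros H He.
  apply (is_lim_seq_le_le (fun _ => 0%R) u e 0 H); auto; apply is_lim_seq_const.
Qed.

Lemma Ccv_le (u : nat -> C) (l : C) (e : nat -> R) :
  (forall n, Cmod (u n - l) <= e n)%R -> is_lim_seq e 0 -> Ccv u l.
Proof.
  intros H He; apply is_lim_seq_squeeze_0 with e; auto.
  intros n; split; auto; apply Cmod_ge_0.
Qed.

Lemma Ccv_ext (u v : nat -> C) (l : C) : (forall n, u n = v n) -> Ccv u l -> Ccv v l.
Proof.
  intros H; apply is_lim_seq_ext; intros n; rewrite H; reflexivity.
Qed.

Lemma Ccv_const (a : C) : Ccv (fun _ => a) a.
Proof.
  apply Ccv_le with (fun _ => 0%R); [|apply is_lim_seq_const].
  intros _; replace (a - a) with (RtoC 0) by ring; rewrite Cmod_0; lra.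
Qed.

Lemma Ccv_plus (u v : nat -> C) (l m : C) :
  Ccv u l -> Ccv v m -> Ccv (fun n => u n + v n) (l + m).
Proof.
  intros Hu Hv.
  apply Ccv_le with (fun n => Cmod (u n - l) + Cmod (v n - m))%R.
  - intros n; replace (u n + v n - (l + m)) with ((u n - l) + (v n - m)) by ring.
    apply Cmod_triangle.
  - replace (Finite 0) with (Rbar_plus 0 0) by (simpl; f_equal; ring).
    apply is_lim_seq_plus'; auto.
Qed.

Lemma Ccv_mult (u v : nat -> C) (l m : C) :
  Ccv u l -> Ccv v m -> Ccv (fun n => u n * v n) (l * m).
Proof.
  intros Hu Hv.
  apply Ccv_le with (fun n => Cmod (u n - l) * Cmod (v n - m) +
     (Cmod (u n - l) * Cmod m + Cmod l * Cmod (v n - m)))%R.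
  - intros n.
    replace (u n * v n - l * m) with
      ((u n - l) * (v n - m) + ((u n - l) * m + l * (v n - m))) by ring.
    eapply Rle_trans; [apply Cmod_triangle|].
    rewrite Cmod_mult; apply Rplus_le_compat_l.
    eapply Rle_trans; [apply Cmod_triangle|].
    rewrite !Cmod_mult; lra.
  - replace (Finite 0) with (Finite (0 * 0 + (0 * Cmod m + Cmod l * 0))) by (f_equal; ring).
    apply is_lim_seq_plus'; [apply is_lim_seq_mult'; auto|].
    apply is_lim_seq_plus'; apply is_lim_seq_mult'; auto; apply is_lim_seq_const.
Qed.

Lemma Ccv_subseq (u : nat -> C) (l : C) (phi : nat -> nat) :
  (forall n, phi n < phi (S n))%nat -> Ccv u l -> Ccv (fun n => u (phi n)) l.
Proof.
  intros H Hu.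
  apply (is_lim_seq_subseq (fun n => Cmod (u n - l)) 0 phi); auto.
  apply eventually_subseq; auto.
Qed.

Lemma Ccv_Re_Im (u : nat -> C) (l : C) : Ccv u l ->
  is_lim_seq (fun n => Re (u n)) (Re l) /\ is_lim_seq (fun n => Im (u n)) (Im l).
Proof.
  intros H.
  (* Real and imaginary parts are treated at once, as additive functionals dominated by the
     modulus. *)
  assert (K : forall p : C -> R, (forall z, Rabs (p z) <= Cmod z)%R ->
    (forall z w : C, p (z - w)%C = (p z - p w)%R) -> is_lim_seq (fun n => p (u n)) (p l)).
  { intros p Hp Hm.
    apply is_lim_seq_ext with (fun n => (p (u n) - p l) + p l)%R; [intros; ring|].
    replace (Finite (p l)) with (Finite (0 + p l)) by (f_equal; ring).
    apply is_lim_seq_plus'; [|apply is_lim_seq_const].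
    apply is_lim_seq_abs_0.
    apply is_lim_seq_squeeze_0 with (2 := H).
    intros n; split; [apply Rabs_pos|]. rewrite <- Hm; apply Hp. }
  split; apply K; try reflexivity; intros z.
  - apply re_le_Cmod.
  - eapply Rle_trans; [apply Rmax_r|apply Rmax_Cmod].
Qed.

Lemma Ccv_unique (u : nat -> C) (l m : C) : Ccv u l -> Ccv u m -> l = m.
Proof.
  intros H1 H2.
  apply Ccv_Re_Im in H1; apply Ccv_Re_Im in H2.
  destruct H1 as [R1 I1], H2 as [R2 I2].
  apply is_lim_seq_unique in R1, I1, R2, I2.
  apply injective_projections; unfold Re, Im in *; congruence.
Qed.

Lemma Ccv_Clim_seq (u : nat -> C) (l : C) : Ccv u l -> Clim_seq u = l.
Proof.
  intros H; apply Ccv_Re_Im in H; destruct H as [H1 H2].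
  unfold Clim_seq.
  apply is_lim_seq_unique in H1, H2; rewrite H1, H2.
  apply injective_projections; reflexivity.
Qed.

Lemma Ccv_Cmod_le (u : nat -> C) (l : C) (M : R) :
  Ccv u l -> (forall n, Cmod (u n) <= M)%R -> (Cmod l <= M)%R.
Proof.
  intros H Hb.
  apply le_epsilon; intros eps He.
  apply is_lim_seq_spec in H.
  destruct (H (mkposreal eps He)) as [n Hn].
  specialize (Hn n (le_n n)); simpl in Hn.
  rewrite Rminus_0_r, Rabs_pos_eq in Hn by apply Cmod_ge_0.
  replace l with (u n + - (u n - l)) by ring.
  eapply Rle_trans; [apply Cmod_triangle|].
  rewrite Cmod_opp; specialize (Hb n); lra.
Qed.

(** Completeness in the form that infinite products need: each component of $u_n-u_0$ is a
    telescoping series dominated by $\sum a_n$. *)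
Lemma Ccv_of_summable_increments (u : nat -> C) (a : nat -> R) :
  (forall n, Cmod (u (S n) - u n) <= a n)%R -> ex_series a -> exists l, Ccv u l.
Proof.
  intros H Ha.
  assert (K : forall p : C -> R, (forall z, Rabs (p z) <= Cmod z)%R ->
    (forall z w : C, p (z - w)%C = (p z - p w)%R) ->
    exists l : R, is_lim_seq (fun n => p (u n)) l).
  { intros p Hp Hm.
    destruct (ex_series_le (fun n => p (u (S n) - u n)%C) a) as [l Hl]; auto.
    - intros n; eapply Rle_trans; [apply Hp|apply H].
    - exists (l + p (u O))%R; apply is_lim_seq_incr_1.
      apply is_lim_seq_ext with
        (fun n => sum_n (fun n => p (u (S n) - u n)%C) n + p (u O))%R.
      + intros n; induction n as [|n IH].
        * rewrite sum_O, Hm; ring.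
        * rewrite sum_Sn; unfold plus; simpl.
          rewrite (Hm (u (S (S n)))), <- IH; ring.
      + apply is_lim_seq_plus'; [exact Hl|apply is_lim_seq_const]. }
  destruct (K Re) as [l1 H1]; [apply re_le_Cmod|reflexivity|].
  destruct (K Im) as [l2 H2];
    [intros z; eapply Rle_trans; [apply Rmax_r|apply Rmax_Cmod]|reflexivity|].
  exists (l1, l2).
  apply Ccv_le with (fun n => sqrt 2 * (Rabs (Re (u n) - l1) + Rabs (Im (u n) - l2)))%R.
  - intros n; eapply Rle_trans; [apply Cmod_2Rmax|].
    apply Rmult_le_compat_l; [apply sqrt_pos|].
    apply Rmax_lub; simpl;
    pose proof (Rabs_pos (Re (u n) - l1)); pose proof (Rabs_pos (Im (u n) - l2));
    unfold Re, Im, Rminus in *; lra.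
  - replace (Finite 0) with (Finite (sqrt 2 * (0 + 0))) by (f_equal; ring).
    apply is_lim_seq_mult'; [apply is_lim_seq_const|].
    apply is_lim_seq_plus'; [apply (is_lim_seq_abs_0 (fun n => Re (u n) - l1)%R)
                            |apply (is_lim_seq_abs_0 (fun n => Im (u n) - l2)%R)].
    + replace (Finite 0) with (Finite (l1 - l1)) by (f_equal; ring).
      apply is_lim_seq_minus'; [exact H1|apply is_lim_seq_const].
    + replace (Finite 0) with (Finite (l2 - l2)) by (f_equal; ring).
      apply is_lim_seq_minus'; [exact H2|apply is_lim_seq_const].
Qed.

(** * Euler products *)

Lemma Cprod_ext (f g : nat -> C) (m : nat) :
  (forall n, (1 <= n)%nat -> f n = g n) -> Cprod f m = Cprod g m.
Proof.
  intros H; induction m as [|m IH]; simpl; [reflexivity|].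
  rewrite IH, H by lia; reflexivity.
Qed.

Lemma Cprod_mul (f g : nat -> C) (m : nat) :
  Cprod (fun n => f n * g n) m = Cprod f m * Cprod g m.
Proof.
  induction m as [|m IH]; simpl; [|rewrite IH]; ring.
Qed.

Lemma Cprod_shift (f : nat -> C) (m : nat) :
  Cprod f (S m) = f 1%nat * Cprod (fun n => f (S n)) m.
Proof.
  induction m as [|m IH]; [simpl; ring|].
  change (Cprod f (S (S m))) with (Cprod f (S m) * f (S (S m))).
  rewrite IH; simpl; ring.
Qed.

Lemma Cprod_blocks2 (f : nat -> C) (m : nat) :
  Cprod f (2 * m) = Cprod (fun n => f (2 * n - 1)%nat * f (2 * n)%nat) m.
Proof.
  induction m as [|m IH]; [reflexivity|].
  replace (2 * S m)%nat with (S (S (2 * m))) by lia.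
  change (Cprod ?g (S m)) with (Cprod g m * g (S m)).
  change (Cprod f (S (S (2 * m)))) with
    (Cprod f (2 * m) * f (S (2 * m)) * f (S (S (2 * m)))).
  rewrite IH; cbv beta.
  replace (2 * S m - 1)%nat with (S (2 * m)) by lia.
  replace (2 * S m)%nat with (S (S (2 * m))) by lia.
  ring.
Qed.

Lemma Cprod_blocks3 (f : nat -> C) (m : nat) :
  Cprod f (3 * m) =
  Cprod (fun n => f (3 * n - 2)%nat * f (3 * n - 1)%nat * f (3 * n)%nat) m.
Proof.
  induction m as [|m IH]; [reflexivity|].
  replace (3 * S m)%nat with (S (S (S (3 * m)))) by lia.
  change (Cprod ?g (S m)) with (Cprod g m * g (S m)).
  change (Cprod f (S (S (S (3 * m))))) with
    (Cprod f (3 * m) * f (S (3 * m)) * f (S (S (3 * m))) * f (S (S (S (3 * m))))).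
  rewrite IH; cbv beta.
  replace (3 * S m - 2)%nat with (S (3 * m)) by lia.
  replace (3 * S m - 1)%nat with (S (S (3 * m))) by lia.
  replace (3 * S m)%nat with (S (S (S (3 * m)))) by lia.
  ring.
Qed.

Lemma Cprod_neq_0 (f : nat -> C) (m : nat) :
  (forall n, (1 <= n)%nat -> f n <> 0) -> Cprod f m <> 0.
Proof.
  intros H; induction m as [|m IH]; simpl; [apply C1_nz|].
  apply Cmult_neq_0; auto; apply H; lia.
Qed.

(** Closed form of $r+r^2+\dots+r^m$. *)
Definition geom_sum (r : R) (m : nat) : R := (r * (1 - r ^ m) / (1 - r))%R.

Lemma geom_sum_S (r : R) (m : nat) :
  (r < 1)%R -> geom_sum r (S m) = (geom_sum r m + r ^ S m)%R.
Proof.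
  intros H; unfold geom_sum; simpl; field; lra.
Qed.

Lemma geom_sum_le (r : R) (m : nat) :
  (0 <= r < 1)%R -> (geom_sum r m <= r / (1 - r))%R.
Proof.
  intros H; unfold geom_sum, Rdiv.
  apply Rmult_le_compat_r; [left; apply Rinv_0_lt_compat; lra|].
  pose proof (pow_le r m (proj1 H)); nra.
Qed.

(** If $|f_n-1|\le x_n$ for all $n$, then $|\prod f_n-1|\le\prod(1+x_n)-1$, and $1+x\le e^x$ turns
    the product into the exponential of a geometric sum. *)
Lemma Cmod_Cprod_minus_1_geom (f : nat -> C) (K r : R) (m : nat) :
  (0 <= K)%R -> (0 <= r < 1)%R ->
  (forall n, (1 <= n)%nat -> (Cmod (f n - 1) <= K * r ^ n)%R) ->
  (Cmod (Cprod f m - 1) <= exp (K * geom_sum r m) - 1)%R.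
Proof.
  intros K_ge0 r_bd f_near1; induction m as [|m IH]; simpl Cprod.
  - replace (1 - 1) with (RtoC 0) by ring.
    unfold geom_sum; simpl; unfold Rdiv; rewrite Cmod_0, Rminus_diag, Rmult_0_r, Rmult_0_l, Rmult_0_r, exp_0; lra.
  - replace (Cprod f m * f (S m) - 1) with
      ((Cprod f m - 1) + ((Cprod f m - 1) * (f (S m) - 1) + (f (S m) - 1))) by ring.
    rewrite geom_sum_S, Rmult_plus_distr_l, exp_plus by lra.
    assert (H1 := f_near1 (S m) ltac:(lia)).
    assert (H2 := exp_ineq1_le (K * r ^ S m)).
    assert (H3 := Cmod_ge_0 (Cprod f m - 1)); assert (H4 := Cmod_ge_0 (f (S m) - 1)).
    eapply Rle_trans; [apply Cmod_triangle|].
    eapply Rle_trans; [apply Rplus_le_compat_l, Cmod_triangle|].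
    rewrite Cmod_mult.
    assert (H5 := exp_pos (K * geom_sum r m)); nra.
Qed.

Lemma Cmod_Cprod_minus_1 (f : nat -> C) (K r : R) (m : nat) :
  (0 <= K)%R -> (0 <= r < 1)%R ->
  (forall n, (1 <= n)%nat -> (Cmod (f n - 1) <= K * r ^ n)%R) ->
  (Cmod (Cprod f m - 1) <= exp (K * (r / (1 - r))) - 1)%R.
Proof.
  intros K_ge0 r_bd f_near1.
  eapply Rle_trans; [apply (Cmod_Cprod_minus_1_geom f K r); auto|].
  apply Rplus_le_compat_r.
  destruct (Rle_lt_or_eq_dec (K * geom_sum r m) (K * (r / (1 - r)))) as [H|H].
  - apply Rmult_le_compat_l; auto; apply geom_sum_le; auto.
  - left; apply exp_increasing; auto.
  - rewrite H; lra.
Qed.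

Lemma Cprod_geom_cv (f : nat -> C) (K r : R) :
  (0 <= K)%R -> (0 <= r < 1)%R ->
  (forall n, (1 <= n)%nat -> (Cmod (f n - 1) <= K * r ^ n)%R) ->
  exists l, Ccv (Cprod f) l.
Proof.
  intros K_ge0 r_bd f_near1.
  apply Ccv_of_summable_increments with
    (fun n => exp (K * (r / (1 - r))) * K * r * r ^ n)%R.
  - intros n; simpl.
    replace (Cprod f n * f (S n) - Cprod f n) with (Cprod f n * (f (S n) - 1)) by ring.
    rewrite Cmod_mult, 2!Rmult_assoc.
    apply Rmult_le_compat; try apply Cmod_ge_0.
    + replace (Cprod f n) with ((Cprod f n - 1) + 1) by ring.
      eapply Rle_trans; [apply Cmod_triangle|].
      rewrite Cmod_1; pose proof (Cmod_Cprod_minus_1 f K r n K_ge0 r_bd f_near1); lra.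
    + apply (f_near1 (S n)); lia.
  - apply @ex_series_scal_l, ex_series_geom.
    rewrite Rabs_pos_eq; lra.
Qed.

(* The q-Pochhammer symbol [(qx; q)_oo]. *)
Definition Eul (q x : C) : C := infprod (fun n => 1 - q ^ n * x).

Lemma Eul_factor_near_1 (q x : C) (n : nat) :
  (1 <= n)%nat -> (Cmod (1 - q ^ n * x - 1) <= Cmod x * Cmod q ^ n)%R.
Proof.
  intros _; replace (1 - q ^ n * x - 1) with (- (q ^ n * x)) by ring.
  rewrite Cmod_opp, Cmod_mult, Cmod_pow; lra.
Qed.

Lemma Eul_cv (q x : C) : (Cmod q < 1)%R -> Ccv (Cprod (fun n => 1 - q ^ n * x)) (Eul q x).
Proof.
  intros Hq.
  destruct (Cprod_geom_cv (fun n => 1 - q ^ n * x) (Cmod x) (Cmod q)) as [l Hl].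
  - apply Cmod_ge_0.
  - split; [apply Cmod_ge_0|auto].
  - apply Eul_factor_near_1.
  - unfold Eul, infprod; rewrite (Ccv_Clim_seq _ _ Hl); auto.
Qed.

Lemma Eul_of_cv (q x l : C) :
  (Cmod q < 1)%R -> Ccv (Cprod (fun n => 1 - q ^ n * x)) l -> Eul q x = l.
Proof.
  intros Hq H; eapply Ccv_unique; [apply Eul_cv|]; auto.
Qed.

Lemma Eul_step (q x : C) : (Cmod q < 1)%R -> Eul q x = (1 - q * x) * Eul q (q * x).
Proof.
  intros Hq.
  eapply Ccv_unique.
  - apply (Ccv_subseq (Cprod (fun n => 1 - q ^ n * x)) _ S); [lia|apply Eul_cv; auto].
  - eapply Ccv_ext; [|apply Ccv_mult; [apply Ccv_const|apply Eul_cv; auto]].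
    intros m; cbv beta; rewrite Cprod_shift, Cpow_1_r; f_equal.
    apply Cprod_ext; intros n _; rewrite Cpow_S; ring.
Qed.

Lemma Eul_near_1 (q x : C) : (Cmod q < 1)%R ->
  (Cmod (Eul q x - 1) <= exp (Cmod x * (Cmod q / (1 - Cmod q))) - 1)%R.
Proof.
  intros Hq.
  apply Ccv_Cmod_le with (fun m => Cprod (fun n => 1 - q ^ n * x) m + - (1)).
  - apply Ccv_plus; [apply Eul_cv; auto|apply Ccv_const].
  - intros m; apply Cmod_Cprod_minus_1; [apply Cmod_ge_0| |apply Eul_factor_near_1].
    split; [apply Cmod_ge_0|auto].
Qed.

Lemma Eul_iter (q x : C) (m : nat) : (Cmod q < 1)%R ->
  Eul q x = Cprod (fun n => 1 - q ^ n * x) m * Eul q (q ^ m * x).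
Proof.
  intros Hq; induction m as [|m IH]; simpl.
  - rewrite !Cmult_1_l; reflexivity.
  - rewrite IH, (Eul_step q (q ^ m * x)) by auto.
    replace (q * (q ^ m * x)) with (q * q ^ m * x) by ring; ring.
Qed.

(** Splitting off $m$ nonzero factors leaves the tail [Eul q (q ^ m * x)]; as soon as $|q|^m s<\ln
    2$, this tail is at distance less than 1 from 1. *)
Lemma Eul_neq_0 (q x : C) : (Cmod q < 1)%R ->
  (forall n, (1 <= n)%nat -> 1 - q ^ n * x <> 0) -> Eul q x <> 0.
Proof.
  intros Hq H.
  set (s := (Cmod x * (Cmod q / (1 - Cmod q)))%R).
  assert (Hs : is_lim_seq (fun m => Cmod q ^ m * s)%R 0).
  { replace (Finite 0) with (Finite (0 * s)) by (f_equal; ring).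
    apply is_lim_seq_mult'; [apply is_lim_seq_geom|apply is_lim_seq_const].
    rewrite Rabs_pos_eq; [auto|apply Cmod_ge_0]. }
  apply is_lim_seq_spec in Hs.
  assert (H2 : (0 < ln 2)%R) by (rewrite <- ln_1; apply ln_increasing; lra).
  destruct (Hs (mkposreal _ H2)) as [m Hm].
  specialize (Hm m (le_n m)); simpl in Hm; rewrite Rminus_0_r in Hm.
  apply Rabs_def2 in Hm; destruct Hm as [Hm _].
  rewrite (Eul_iter q x m) by auto.
  apply Cmult_neq_0; [apply Cprod_neq_0; auto|].
  intros E.
  assert (H3 := Eul_near_1 q (q ^ m * x) Hq).
  rewrite E in H3.
  replace (0 - 1) with (- (1)) in H3 by ring.
  rewrite Cmod_m1, Cmod_mult, Cmod_pow, Rmult_assoc in H3.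
  apply exp_increasing in Hm; rewrite exp_ln in Hm by lra.
  fold s in H3; lra.
Qed.

Lemma Cmod_pow_lt_1 (q : C) (n : nat) : (Cmod q < 1)%R -> (Cmod (q ^ S n) < 1)%R.
Proof.
  intros Hq; rewrite Cmod_pow.
  pose proof (Cmod_ge_0 q).
  apply Rle_lt_trans with (Cmod q); auto.
  assert (H1 : (Cmod q ^ n <= 1)%R) by (rewrite <- (pow1 n); apply pow_incr; lra).
  simpl; nra.
Qed.

Lemma Eul_mul_opp (q x : C) : (Cmod q < 1)%R ->
  Eul q x * Eul q (- x) = Eul (q ^ 2) (x ^ 2).
Proof.
  intros Hq; symmetry; apply Eul_of_cv; [apply (Cmod_pow_lt_1 q 1); auto|].
  eapply Ccv_ext; [|apply Ccv_mult; apply Eul_cv; auto].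
  intros m; cbv beta; rewrite <- Cprod_mul; apply Cprod_ext; intros n _.
  rewrite <- Cpow_mult_r, Nat.mul_comm, Cpow_mult_r; ring.
Qed.

Lemma Eul_mul_cube_roots (q x w : C) : (Cmod q < 1)%R -> w ^ 2 + w + 1 = 0 ->
  Eul q x * Eul q (w * x) * Eul q (w ^ 2 * x) = Eul (q ^ 3) (x ^ 3).
Proof.
  intros Hq Hw; symmetry; apply Eul_of_cv; [apply (Cmod_pow_lt_1 q 2); auto|].
  eapply Ccv_ext; [|apply Ccv_mult; [apply Ccv_mult|]; apply Eul_cv; auto].
  intros m; cbv beta; rewrite <- !Cprod_mul; apply Cprod_ext; intros n _.
  rewrite <- Cpow_mult_r, Nat.mul_comm, Cpow_mult_r.
  set (y := q ^ n).
  assert (W : w ^ 2 = - w - 1) by (rewrite <- (Cplus_0_r (- w - 1)), <- Hw; ring).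
  transitivity (1 - (w ^ 2 + w + 1) * (y * x) +
     (w ^ 2 + w + 1) * w * (y * x) ^ 2 - (w ^ 2 * w) * (y * x) ^ 3); [ring|].
  replace (w ^ 2 * w) with (RtoC 1).
  - rewrite Hw; ring.
  - rewrite W; transitivity (- (w ^ 2) - w); [rewrite W|]; ring.
Qed.

(** The exponents $2,3,4,\dots$ of $q$ on the left are sorted by parity. The argument $qx$ makes
    them start at 2, so that both subproducts are complete; for the same reason [Eul_split3] has
    $q^2x$. *)
Lemma Eul_split2 (q x : C) : (Cmod q < 1)%R ->
  Eul q (q * x) = Eul (q ^ 2) x * Eul (q ^ 2) (q * x).
Proof.
  intros Hq.
  assert (Hq2 := Cmod_pow_lt_1 q 1 Hq).
  eapply Ccv_unique.
  - apply (Ccv_subseq (Cprod (fun n => 1 - q ^ n * (q * x))) _ (fun m => 2 * m)%nat); [lia|apply Eul_cv; auto].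
  - eapply Ccv_ext; [|apply Ccv_mult; apply Eul_cv; auto].
    intros m; cbv beta; rewrite Cprod_blocks2, <- Cprod_mul; apply Cprod_ext; intros n Hn.
    rewrite <- Cpow_mult_r.
    destruct n as [|n]; [lia|].
    replace (2 * S n - 1)%nat with (S (2 * n)) by lia.
    replace (2 * S n)%nat with (S (S (2 * n))) by lia.
    rewrite !Cpow_S; ring.
Qed.

Lemma Eul_split3 (q x : C) : (Cmod q < 1)%R ->
  Eul q (q ^ 2 * x) = Eul (q ^ 3) x * Eul (q ^ 3) (q * x) * Eul (q ^ 3) (q ^ 2 * x).
Proof.
  intros Hq.
  assert (Hq2 := Cmod_pow_lt_1 q 2 Hq).
  eapply Ccv_unique.
  - apply (Ccv_subseq (Cprod (fun n => 1 - q ^ n * (q ^ 2 * x))) _ (fun m => 3 * m)%nat); [lia|apply Eul_cv; auto].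
  - eapply Ccv_ext; [|apply Ccv_mult; [apply Ccv_mult|]; apply Eul_cv; auto].
    intros m; cbv beta; rewrite Cprod_blocks3, <- !Cprod_mul; apply Cprod_ext; intros n Hn.
    rewrite <- Cpow_mult_r.
    destruct n as [|n]; [lia|].
    replace (3 * S n - 2)%nat with (S (3 * n)) by lia.
    replace (3 * S n - 1)%nat with (S (S (3 * n))) by lia.
    replace (3 * S n)%nat with (S (S (S (3 * n)))) by lia.
    rewrite !Cpow_S; ring.
Qed.

Lemma Eul_1_neq_0 (q : C) : (Cmod q < 1)%R -> Eul q 1 <> 0.
Proof.
  intros Hq; apply Eul_neq_0; auto; intros n Hn E.
  destruct n as [|n]; [lia|].
  assert (H := Cmod_pow_lt_1 q n Hq).
  replace (q ^ S n) with (RtoC 1) in H.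
  - rewrite Cmod_1 in H; lra.
  - rewrite <- (Cplus_0_r (q ^ S n)), <- E; ring.
Qed.

(* Euler's identity [prod (1 + q^n) (1 - q^(2n-1)) = 1]. *)
Lemma Eul_level2 (q : C) : (Cmod q < 1)%R ->
  Eul q (- (1)) * (1 - q) * Eul (q ^ 2) q = 1.
Proof.
  intros Hq.
  assert (Hn := Eul_1_neq_0 _ (Cmod_pow_lt_1 q 1 Hq)).
  assert (H1 := Eul_mul_opp q 1 Hq).
  assert (H2 := Eul_step q 1 Hq).
  assert (H3 := Eul_split2 q 1 Hq).
  rewrite !Cmult_1_r in *; rewrite H3 in H2; rewrite H2, Cpow_1_l in H1.
  transitivity (Eul (q ^ 2) 1 / Eul (q ^ 2) 1); [rewrite <- H1 at 1|]; field; auto.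
Qed.

(** The analogue of Euler's identity modulo 3. Sorting exponents modulo 3 gives [Eul q 1] as
    $(1-q)(1-q^2)$ times three products in $q^3$; multiplying by the products at $w$ and $w^2$ gives
    [Eul (q ^ 3) 1], one of those three, which cancels. *)
Lemma Eul_level3 (q w : C) : (Cmod q < 1)%R -> w ^ 2 + w + 1 = 0 ->
  (1 - q) * (1 - q ^ 2) * Eul (q ^ 3) q * Eul (q ^ 3) (q ^ 2) * Eul q w * Eul q (w ^ 2) = 1.
Proof.
  intros Hq Hw.
  assert (Hn := Eul_1_neq_0 _ (Cmod_pow_lt_1 q 2 Hq)).
  assert (H1 := Eul_mul_cube_roots q 1 w Hq Hw).
  assert (H2 := Eul_step q 1 Hq).
  assert (H2' := Eul_step q q Hq).
  assert (H3 := Eul_split3 q 1 Hq).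
  rewrite !Cmult_1_r in *; replace (q * q) with (q ^ 2) in H2' by ring.
  rewrite H2', H3 in H2; rewrite H2, Cpow_1_l in H1.
  transitivity (Eul (q ^ 3) 1 / Eul (q ^ 3) 1); [rewrite <- H1 at 1|]; field; auto.
Qed.

Lemma Theta_Eul (u tau : C) : (Cmod (Cexp (2 * PI * Ci * tau)) < 1)%R ->
  let q := Cexp (2 * PI * Ci * tau) in
  Theta (u, tau) = Cexp (2 * PI * Ci * tau / 12) *
    (Cexp (PI * Ci * u) - Cexp (- (PI * Ci * u))) *
    (Eul q (Cexp (2 * PI * Ci * u)) * Eul q (Cexp (- (2 * PI * Ci * u)))).
Proof.
  intros Hq q; unfold Theta; fold q; rewrite <- !Cexp_opp; f_equal.
  apply Ccv_Clim_seq.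
  eapply Ccv_ext; [|apply Ccv_mult; apply Eul_cv; auto].
  intros m; cbv beta; rewrite <- Cprod_mul; reflexivity.
Qed.

(** * Divided-difference bounds *)

(* On the ball of radius [r], [a], [b], [c] bound [f] and its first and second
   divided differences.  By the Leibniz rule for divided differences the sum
   [a + b + c] is submultiplicative, so bounds survive infinite products, and
   they pass to pointwise limits: this replaces the theory of holomorphic functions. *)
Definition dd_bound (r : R) (f : C -> C) (M : R) : Prop :=
  exists a b c : R, (0 <= a /\ 0 <= b /\ 0 <= c /\ a + b + c <= M)%R /\
  forall u v w, (Cmod u <= r)%R -> (Cmod v <= r)%R -> (Cmod w <= r)%R ->
    (Cmod (f u) <= a)%R /\
    (Cmod (f u - f v) <= b * Cmod (u - v))%R /\
    (Cmod (f u * (v - w) + f v * (w - u) + f w * (u - v)) <=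
      c * (Cmod (u - v) * Cmod (v - w) * Cmod (w - u)))%R.

Definition smooth (f : C -> C) : Prop := forall r, exists M, dd_bound r f M.

Lemma dd_bound_ge0 (r : R) (f : C -> C) (M : R) : dd_bound r f M -> (0 <= M)%R.
Proof.
  intros (a & b & c & H & _); lra.
Qed.

Lemma dd_bound_le (r : R) (f : C -> C) (M M' : R) :
  dd_bound r f M -> (M <= M')%R -> dd_bound r f M'.
Proof.
  intros (a & b & c & H & K) L; exists a, b, c; split; [lra|auto].
Qed.

Lemma dd_bound_ext (r : R) (f g : C -> C) (M : R) :
  (forall u, f u = g u) -> dd_bound r f M -> dd_bound r g M.
Proof.
  intros E (a & b & c & H & K); exists a, b, c; split; auto.
  intros u v w; rewrite <- !E; apply K.
Qed.

Lemma dd_bound_const (r : R) (k : C) : dd_bound r (fun _ => k) (Cmod k).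
Proof.
  exists (Cmod k), 0%R, 0%R; split; [pose proof (Cmod_ge_0 k); lra|].
  intros u v w _ _ _; split; [lra|split].
  - replace (k - k) with (RtoC 0) by ring; rewrite Cmod_0; lra.
  - replace (k * (v - w) + k * (w - u) + k * (u - v)) with (RtoC 0) by ring.
    rewrite Cmod_0; lra.
Qed.

Lemma dd_bound_id (r : R) : (0 <= r)%R -> dd_bound r (fun u => u) (r + 1).
Proof.
  intros Hr; exists r, 1%R, 0%R; split; [lra|].
  intros u v w Hu _ _; split; [auto|split; [lra|]].
  replace (u * (v - w) + v * (w - u) + w * (u - v)) with (RtoC 0) by ring.
  rewrite Cmod_0; lra.
Qed.

Lemma dd_bound_plus (r : R) (f g : C -> C) (M N : R) :
  dd_bound r f M -> dd_bound r g N -> dd_bound r (fun u => f u + g u) (M + N).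
Proof.
  intros (a & b & c & H & K) (a' & b' & c' & H' & K').
  exists (a + a')%R, (b + b')%R, (c + c')%R; split; [lra|].
  intros u v w Hu Hv Hw.
  destruct (K u v w Hu Hv Hw) as (K1 & K2 & K3).
  destruct (K' u v w Hu Hv Hw) as (K1' & K2' & K3').
  split; [|split].
  - eapply Rle_trans; [apply Cmod_triangle|lra].
  - replace (f u + g u - (f v + g v)) with ((f u - f v) + (g u - g v)) by ring.
    eapply Rle_trans; [apply Cmod_triangle|lra].
  - replace ((f u + g u) * (v - w) + (f v + g v) * (w - u) + (f w + g w) * (u - v)) with
      ((f u * (v - w) + f v * (w - u) + f w * (u - v)) +
       (g u * (v - w) + g v * (w - u) + g w * (u - v))) by ring.
    eapply Rle_trans; [apply Cmod_triangle|lra].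
Qed.

Lemma Rmult_le_compat_Cmod (z w : C) (a b : R) :
  (Cmod z <= a)%R -> (Cmod w <= b)%R -> (Cmod (z * w) <= a * b)%R.
Proof.
  intros; rewrite Cmod_mult; apply Rmult_le_compat; auto; apply Cmod_ge_0.
Qed.

Lemma dd_bound_mult (r : R) (f g : C -> C) (M N : R) :
  dd_bound r f M -> dd_bound r g N -> dd_bound r (fun u => f u * g u) (M * N).
Proof.
  intros (a & b & c & H & K) (a' & b' & c' & H' & K').
  (* These are the coefficients of $(a+bX+cX^2)(a'+b'X+c'X^2)$ modulo $X^3$, as in
     $(fg)[u,v,w]=f(u)\,g[u,v,w]+f[u,v]\,g[v,w]+f[u,v,w]\,g(w)$. Truncating only lowers their
     sum. *)
  exists (a * a')%R, (a * b' + b * a')%R, (a * c' + c * a' + b * b')%R; split.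
  { destruct H as (Ha & Hb & Hc & HM), H' as (Ha' & Hb' & Hc' & HN).
    repeat split; try (repeat apply Rplus_le_le_0_compat; apply Rmult_le_pos; auto).
    apply Rle_trans with ((a + b + c) * (a' + b' + c'))%R.
    - assert (0 <= b * c' /\ 0 <= c * b' /\ 0 <= c * c')%R
        by (repeat split; apply Rmult_le_pos; auto); lra.
    - apply Rmult_le_compat; lra. }
  intros u v w Hu Hv Hw.
  destruct (K u v w Hu Hv Hw) as (K1 & K2 & K3).
  destruct (K' u v w Hu Hv Hw) as (K1' & K2' & K3').
  destruct (K' v w u Hv Hw Hu) as (Kv1' & Kvw' & _).
  destruct (K' w u v Hw Hu Hv) as (Kw1' & _ & _).
  split; [|split].
  - apply Rmult_le_compat_Cmod; auto.
  - replace (f u * g u - f v * g v) with (f u * (g u - g v) + (f u - f v) * g v) by ring.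
    eapply Rle_trans; [apply Cmod_triangle|].
    eapply Rle_trans; [apply Rplus_le_compat; apply Rmult_le_compat_Cmod; eauto|].
    right; ring.
  - replace (f u * g u * (v - w) + f v * g v * (w - u) + f w * g w * (u - v)) with
      (f u * (g u * (v - w) + g v * (w - u) + g w * (u - v)) +
       ((f u * (v - w) + f v * (w - u) + f w * (u - v)) * g w +
        (f v - f u) * ((g v - g w) * (w - u)))) by ring.
    eapply Rle_trans; [apply Cmod_triangle|].
    eapply Rle_trans; [apply Rplus_le_compat_l, Cmod_triangle|].
    assert (K2s : (Cmod (f v - f u) <= b * Cmod (u - v))%R).
    { rewrite <- Cmod_opp; replace (- (f v - f u)) with (f u - f v) by ring; auto. }
    eapply Rle_trans; [apply Rplus_le_compat; [apply Rmult_le_compat_Cmod; eauto|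
      apply Rplus_le_compat; [apply Rmult_le_compat_Cmod; eauto|
        apply Rmult_le_compat_Cmod; [eauto|apply Rmult_le_compat_Cmod; [eauto|apply Rle_refl]]]]|].
    right; ring.
Qed.

Lemma dd_bound_pow (r : R) (f : C -> C) (M : R) (n : nat) :
  dd_bound r f M -> dd_bound r (fun u => f u ^ n) (M ^ n).
Proof.
  intros H; induction n as [|n IH]; simpl.
  - eapply dd_bound_le; [apply dd_bound_const|]; rewrite Cmod_1; lra.
  - apply dd_bound_mult; auto.
Qed.

(** The triple $(a,b,c)$ may vary with $n$, but each entry stays below $M$. Hence the limit receives
    the triple $(M,M,M)$, at the price of a factor 3. *)
Lemma dd_bound_lim (r M : R) (f : nat -> C -> C) (g : C -> C) :
  (forall n, dd_bound r (f n) M) -> (forall u, Ccv (fun n => f n u) (g u)) ->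
  dd_bound r g (M + M + M).
Proof.
  intros H Hc.
  assert (HM := dd_bound_ge0 _ _ _ (H O)).
  exists M, M, M; split; [lra|].
  intros u v w Hu Hv Hw.
  assert (X : forall x y : R, (0 <= y -> x <= M -> x * y <= M * y)%R)
    by (intros; apply Rmult_le_compat_r; auto).
  split; [|split].
  - apply (Ccv_Cmod_le _ _ _ (Hc u)); intros n.
    destruct (H n) as (a & b & c & B & K); destruct (K u v w Hu Hv Hw); lra.
  - apply Ccv_Cmod_le with (fun n => f n u + - (1) * f n v).
    + replace (g u - g v) with (g u + - (1) * g v) by ring.
      apply Ccv_plus; auto; apply Ccv_mult; auto; apply Ccv_const.
    + intros n; replace (f n u + - (1) * f n v) with (f n u - f n v) by ring.
      destruct (H n) as (a & b & c & B & K); destruct (K u v w Hu Hv Hw) as (_ & K2 & _).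
      eapply Rle_trans; [apply K2|]; apply X; [apply Cmod_ge_0|lra].
  - apply Ccv_Cmod_le with (fun n => f n u * (v - w) + f n v * (w - u) + f n w * (u - v)).
    + repeat apply Ccv_plus; apply Ccv_mult; auto; apply Ccv_const.
    + intros n.
      destruct (H n) as (a & b & c & B & K); destruct (K u v w Hu Hv Hw) as (_ & _ & K3).
      eapply Rle_trans; [apply K3|]; apply X; [|lra].
      repeat apply Rmult_le_pos; apply Cmod_ge_0.
Qed.

(** * Second-order estimates for exp, sin and cos, and the exponential as a limit of powers *)

Lemma exp_pow_INR (x : R) (n : nat) : (exp x ^ n = exp (INR n * x))%R.
Proof.
  induction n as [|n IH]; [simpl; rewrite Rmult_0_l, exp_0; reflexivity|].
  rewrite S_INR, Rmult_plus_distr_r, exp_plus, <- IH, Rmult_1_l; simpl; ring.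
Qed.

Lemma exp_le_compat (x y : R) : (x <= y -> exp x <= exp y)%R.
Proof.
  intros [H|H]; [left; apply exp_increasing; auto|rewrite H; lra].
Qed.

Lemma Rabs_exp_minus_1_le (x : R) : (Rabs (exp x - 1) <= Rabs x * exp (Rabs x))%R.
Proof.
  assert (H1 := exp_ineq1_le x); assert (H2 := exp_ineq1_le (- x)).
  assert (H3 : (exp x * exp (- x) = 1)%R) by (rewrite <- exp_plus, Rplus_opp_r; apply exp_0).
  assert (H4 := exp_pos x).
  destruct (Rle_lt_dec 0 x) as [L|L].
  - rewrite !Rabs_pos_eq by lra; nra.
  - rewrite Rabs_left1, (Rabs_left1 x) by nra.
    assert (H5 := exp_ineq1_le (- x)); nra.
Qed.

Lemma Rabs_exp_minus_1_minus_id_le (x : R) :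
  (Rabs (exp x - 1 - x) <= x ^ 2 * exp (Rabs x))%R.
Proof.
  assert (H1 := exp_ineq1_le x); assert (H2 := exp_ineq1_le (- x)).
  assert (H3 : (exp x * exp (- x) = 1)%R) by (rewrite <- exp_plus, Rplus_opp_r; apply exp_0).
  assert (H4 := exp_pos x).
  assert (H5 := Rabs_exp_minus_1_le x).
  rewrite Rabs_pos_eq by lra.
  (* This amounts to $e^x-1\le xe^x$, which is $1-x\le e^{-x}$ multiplied by $e^x$. *)
  apply Rle_trans with (x * (exp x - 1))%R; [nra|].
  apply Rle_trans with (Rabs x * Rabs (exp x - 1))%R; [rewrite <- Rabs_mult; apply Rle_abs|].
  rewrite <- (pow2_abs x); pose proof (Rabs_pos x); nra.
Qed.

Lemma Rabs_sin_le (x : R) : (Rabs (sin x) <= Rabs x)%R.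
Proof.
  destruct (Rtotal_order x 0) as [H|[H|H]].
  - assert (H1 := sin_lt_x (- x) ltac:(lra)); rewrite sin_neg in H1.
    rewrite (Rabs_left x) by auto.
    destruct (Rle_lt_dec (-1) x).
    + rewrite Rabs_left1; [lra|].
      left; apply sin_lt_0_var; auto; pose proof PI2_1; lra.
    + pose proof (SIN_bound x); apply Rabs_le; lra.
  - rewrite H, sin_0; lra.
  - assert (H1 := sin_lt_x x H).
    rewrite (Rabs_pos_eq x) by lra.
    destruct (Rle_lt_dec x 1).
    + rewrite Rabs_pos_eq; [lra|].
      apply sin_ge_0; [lra|]; pose proof PI2_1; lra.
    + pose proof (SIN_bound x); apply Rabs_le; lra.
Qed.

Lemma cos_minus_1_eq (x : R) : (cos x - 1 = - (2 * sin (x / 2) ^ 2))%R.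
Proof.
  replace x with (2 * (x / 2))%R at 1 by field.
  rewrite cos_2a_sin; ring.
Qed.

Lemma Rabs_cos_minus_1_le_sqr (x : R) : (Rabs (cos x - 1) <= x ^ 2)%R.
Proof.
  rewrite cos_minus_1_eq, Rabs_Ropp, Rabs_pos_eq by (pose proof (pow2_ge_0 (sin (x / 2))); lra).
  assert (H := Rabs_sin_le (x / 2)).
  rewrite <- (pow2_abs (sin _)), <- (pow2_abs x).
  rewrite Rabs_div, (Rabs_pos_eq 2) in H by lra.
  pose proof (Rabs_pos (sin (x / 2))); pose proof (Rabs_pos x); nra.
Qed.

Lemma Rabs_cos_minus_1_le (x : R) : (Rabs (cos x - 1) <= Rabs x)%R.
Proof.
  rewrite cos_minus_1_eq, Rabs_Ropp, Rabs_pos_eq by (pose proof (pow2_ge_0 (sin (x / 2))); lra).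
  assert (H := Rabs_sin_le (x / 2)).
  assert (H1 : (Rabs (sin (x / 2)) <= 1)%R) by (apply Rabs_le; pose proof (SIN_bound (x / 2)); lra).
  rewrite <- (pow2_abs (sin _)).
  rewrite Rabs_div, (Rabs_pos_eq 2) in H by lra.
  pose proof (Rabs_pos (sin (x / 2))); nra.
Qed.

Lemma Rabs_sin_minus_id_le (x : R) : (Rabs (sin x - x) <= x ^ 2)%R.
Proof.
  destruct (MVT_gen (fun t => sin t - t)%R 0 x (fun t => cos t - 1)%R) as (c & Hc & E).
  - intros t _; auto_derive; auto; ring.
  - intros t _; apply continuity_pt_minus.
    + apply continuity_sin.
    + apply continuity_pt_id.
  - rewrite sin_0, !Rminus_0_r in E; rewrite E, Rabs_mult, <- (pow2_abs x).
    replace (Rabs x ^ 2)%R with (Rabs x * Rabs x)%R by ring.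
    apply Rmult_le_compat_r; [apply Rabs_pos|].
    eapply Rle_trans; [apply Rabs_cos_minus_1_le|].
    destruct (Rle_lt_dec 0 x).
    + rewrite Rmin_left, Rmax_right in Hc by lra; rewrite !Rabs_pos_eq; lra.
    + rewrite Rmin_right, Rmax_left in Hc by lra; rewrite !Rabs_left1; lra.
Qed.

Lemma Cmod_le_Rabs_plus (z : C) : (Cmod z <= Rabs (Re z) + Rabs (Im z))%R.
Proof.
  destruct z as [x y]; simpl.
  replace (x, y) with (RtoC x + Ci * RtoC y)
    by (apply injective_projections; simpl; ring).
  eapply Rle_trans; [apply Cmod_triangle|].
  rewrite Cmod_mult, Cmod_Ci, !Cmod_R; lra.
Qed.

(** For $z=x+iy$ the real part of the error is $(e^x-1-x)+e^x(\cos y-1)$ and the imaginary part is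
    $(e^x-1)\sin y+(\sin y-y)$; each of the four terms is at most $|z|^2e^{|z|}$. *)
Lemma Cmod_Cexp_minus_1_minus_id_le (z : C) :
  (Cmod (Cexp z - 1 - z) <= 4 * (Cmod z ^ 2 * exp (Cmod z)))%R.
Proof.
  assert (Hx : (Rabs (Re z) <= Cmod z)%R) by apply re_le_Cmod.
  assert (Hy : (Rabs (Im z) <= Cmod z)%R)
    by (eapply Rle_trans; [apply Rmax_r|apply Rmax_Cmod]).
  eapply Rle_trans; [apply Cmod_le_Rabs_plus|].
  destruct z as [x y]; set (m := Cmod (x, y)) in *; simpl in *.
  assert (He := exp_le_compat _ _ Hx).
  assert (Hex : (exp x <= exp m)%R) by (apply exp_le_compat; pose proof (Rle_abs x); lra).
  assert (H0 := exp_pos (Rabs x)); assert (H0' := exp_pos x).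
  assert (Hm1 : (1 <= exp m)%R).
  { rewrite <- exp_0; apply exp_le_compat, Cmod_ge_0. }
  assert (X := Rabs_pos x); assert (Y := Rabs_pos y).
  assert (X2 : (x ^ 2 <= m ^ 2)%R) by (rewrite <- (pow2_abs x); apply pow_incr; auto).
  assert (Y2 : (y ^ 2 <= m ^ 2)%R) by (rewrite <- (pow2_abs y); apply pow_incr; auto).
  assert (M2 := pow2_ge_0 m).
  assert (X0 := pow2_ge_0 x); assert (Y0 := pow2_ge_0 y).
  replace (exp x * cos y + - (1) + - x)%R
    with ((exp x - 1 - x) + exp x * (cos y - 1))%R by ring.
  replace (exp x * sin y + - 0 + - y)%R
    with ((exp x - 1) * sin y + (sin y - y))%R by ring.
  assert (B1 : (Rabs (exp x - 1 - x) <= m ^ 2 * exp m)%R).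
  { eapply Rle_trans; [apply Rabs_exp_minus_1_minus_id_le|].
    apply Rmult_le_compat; auto; lra. }
  assert (B2 : (Rabs (exp x * (cos y - 1)) <= m ^ 2 * exp m)%R).
  { rewrite Rabs_mult, (Rabs_pos_eq (exp x)), Rmult_comm by lra.
    apply Rmult_le_compat; auto; [apply Rabs_pos|lra|].
    eapply Rle_trans; [apply Rabs_cos_minus_1_le_sqr|auto]. }
  assert (B3 : (Rabs ((exp x - 1) * sin y) <= m ^ 2 * exp m)%R).
  { rewrite Rabs_mult.
    apply Rle_trans with ((m * exp m) * m)%R; [|right; ring].
    apply Rmult_le_compat; try apply Rabs_pos.
    - eapply Rle_trans; [apply Rabs_exp_minus_1_le|]; apply Rmult_le_compat; lra.
    - eapply Rle_trans; [apply Rabs_sin_le|auto]. }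
  assert (B4 : (Rabs (sin y - y) <= m ^ 2 * exp m)%R).
  { eapply Rle_trans; [apply Rabs_sin_minus_id_le|]; nra. }
  pose proof (Rabs_triang (exp x - 1 - x) (exp x * (cos y - 1))).
  pose proof (Rabs_triang ((exp x - 1) * sin y) (sin y - y)).
  simpl in *; lra.
Qed.

Lemma Cpow_minus_le (a b : C) (m : R) (n : nat) :
  (Cmod a <= m)%R -> (Cmod b <= m)%R -> (1 <= m)%R ->
  (Cmod (a ^ n - b ^ n) <= INR n * m ^ n * Cmod (a - b))%R.
Proof.
  intros Ha Hb Hm; induction n as [|n IH].
  - simpl; replace (1 - 1) with (RtoC 0) by ring; rewrite Cmod_0; lra.
  - rewrite S_INR, !Cpow_S.
    replace (a * a ^ n - b * b ^ n) with (a * (a ^ n - b ^ n) + (a - b) * b ^ n) by ring.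
    eapply Rle_trans; [apply Cmod_triangle|].
    rewrite !Cmod_mult, Cmod_pow.
    assert (H1 : (Cmod b ^ n <= m * m ^ n)%R).
    { eapply Rle_trans; [apply pow_incr; split; [apply Cmod_ge_0|eauto]|].
      pose proof (pow_le m n ltac:(lra)); nra. }
    assert (H2 : (Cmod a * Cmod (a ^ n - b ^ n) <= m * (INR n * m ^ n * Cmod (a - b)))%R)
      by (apply Rmult_le_compat; auto; apply Cmod_ge_0).
    pose proof (Cmod_ge_0 (a - b)); simpl; nra.
Qed.

Lemma is_lim_seq_div_S (k : R) : is_lim_seq (fun n => k / INR (S n))%R 0.
Proof.
  apply (is_lim_seq_incr_1 (fun n => k / INR n)%R).
  replace (Finite 0) with (Finite (k * 0)) by (f_equal; ring).
  apply is_lim_seq_mult'; [apply is_lim_seq_const|].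
  apply (is_lim_seq_inv INR p_infty); [apply is_lim_seq_INR|discriminate].
Qed.

(** Presents [Cexp] in the form to which [dd_bound_lim] applies. With $k$ factors, $1+z/k$ differs
    from $e^{z/k}$ by $O(1/k^2)$, and [Cpow_minus_le] costs only a factor of order $k$. *)
Lemma Cexp_compound_cv (z : C) : Ccv (fun n => (1 + z / INR (S n)) ^ S n) (Cexp z).
Proof.
  apply Ccv_le with (fun n => 4 * Cmod z ^ 2 * exp (2 * Cmod z) / INR (S n))%R;
    [|apply is_lim_seq_div_S].
  intros n; set (k := S n).
  assert (P : (1 <= INR k)%R) by (apply (le_INR 1); unfold k; lia).
  assert (P' : RtoC (INR k) <> 0) by (intros E; apply RtoC_inj in E; lra).
  assert (Hz := Cmod_ge_0 z).
  assert (Hzk : Cmod (z / INR k) = (Cmod z / INR k)%R).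
  { rewrite Cmod_div, Cmod_R, Rabs_pos_eq by (auto; lra); reflexivity. }
  assert (Hzk0 : (0 <= Cmod z / INR k)%R) by (rewrite <- Hzk; apply Cmod_ge_0).
  assert (Hzk1 : (Cmod z / INR k <= Cmod z)%R).
  { apply Rle_div_l; [lra|]; nra. }
  replace z with (INR k * (z / INR k)) at 2 by (field; auto).
  rewrite <- Cexp_pow.
  eapply Rle_trans; [apply Cpow_minus_le with (m := exp (Cmod (z / INR k)))|].
  - eapply Rle_trans; [apply Cmod_triangle|]; rewrite Cmod_1; apply exp_ineq1_le.
  - rewrite Cmod_Cexp; apply exp_le_compat.
    eapply Rle_trans; [apply Rle_abs|apply re_le_Cmod].
  - rewrite <- exp_0; apply exp_le_compat, Cmod_ge_0.
  - replace (Cmod (1 + z / INR k - Cexp (z / INR k)))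
      with (Cmod (Cexp (z / INR k) - 1 - z / INR k)) by (rewrite <- Cmod_opp; f_equal; ring).
    eapply Rle_trans; [apply Rmult_le_compat_l; [|apply Cmod_Cexp_minus_1_minus_id_le]|].
    { apply Rmult_le_pos; [lra|apply pow_le; left; apply exp_pos]. }
    rewrite Hzk, exp_pow_INR.
    replace (INR k * (Cmod z / INR k))%R with (Cmod z) by (field; lra).
    apply Rle_trans with (INR k * exp (Cmod z) * (4 * ((Cmod z / INR k) ^ 2 * exp (Cmod z))))%R.
    + apply Rmult_le_compat_l; [apply Rmult_le_pos; [lra|left; apply exp_pos]|].
      apply Rmult_le_compat_l; [lra|].
      apply Rmult_le_compat_l; [apply pow2_ge_0|apply exp_le_compat; auto].
    + right; replace (2 * Cmod z)%R with (Cmod z + Cmod z)%R by ring.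
      rewrite exp_plus; field; lra.
Qed.

(** The $k$-th power of $1+f/k$ is bounded by $(1+M/k)^k\le e^M$, uniformly in $k$; the 3 is the
    loss in [dd_bound_lim]. The same scheme serves [dd_bound_Eul], with $\prod(1+M|q|^k)$. *)
Lemma dd_bound_Cexp (r : R) (f : C -> C) (M : R) :
  dd_bound r f M -> dd_bound r (fun u => Cexp (f u)) (3 * exp M).
Proof.
  intros H.
  eapply dd_bound_le; [apply dd_bound_lim with
    (M := exp M) (f := fun n u => (1 + f u / INR (S n)) ^ S n)|lra].
  - intros n.
    assert (P : (0 < INR (S n))%R) by apply (lt_0_INR (S n)), Nat.lt_0_succ.
    assert (P' : RtoC (INR (S n)) <> 0) by (intros E; apply RtoC_inj in E; lra).
    eapply dd_bound_le; [apply dd_bound_pow, dd_bound_plus;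
      [apply dd_bound_const|apply dd_bound_mult; [exact H|apply dd_bound_const]]|].
    rewrite Cmod_1, Cmod_inv, Cmod_R, Rabs_pos_eq by (auto; lra).
    assert (HM := dd_bound_ge0 _ _ _ H).
    apply Rle_trans with (exp (M * / INR (S n)) ^ S n)%R.
    + apply pow_incr; split; [|apply exp_ineq1_le].
      apply Rplus_le_le_0_compat; [lra|].
      apply Rmult_le_pos; [auto|left; apply Rinv_0_lt_compat; auto].
    + rewrite exp_pow_INR; right; f_equal; field; lra.
  - intros u; apply Cexp_compound_cv.
Qed.

Lemma dd_bound_Eul (r : R) (q : C) (f : C -> C) (M : R) :
  (Cmod q < 1)%R -> dd_bound r f M ->
  dd_bound r (fun u => Eul q (f u)) (3 * exp (M * (Cmod q / (1 - Cmod q)))).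
Proof.
  intros Hq H.
  assert (HM := dd_bound_ge0 _ _ _ H).
  assert (Hq0 := Cmod_ge_0 q).
  eapply dd_bound_le; [apply dd_bound_lim with
    (M := exp (M * (Cmod q / (1 - Cmod q)))) (f := fun n u => Cprod (fun k => 1 - q ^ k * f u) n)|lra].
  - intros n; apply dd_bound_le with (exp (M * geom_sum (Cmod q) n))%R.
    + induction n as [|n IH]; simpl Cprod.
      * eapply dd_bound_le; [apply dd_bound_const|].
        unfold geom_sum; simpl; unfold Rdiv.
        rewrite Rminus_diag, Rmult_0_r, Rmult_0_l, Rmult_0_r, exp_0, Cmod_1; lra.
      * rewrite geom_sum_S, Rmult_plus_distr_l, exp_plus by auto.
        apply dd_bound_mult; [exact IH|].
        eapply dd_bound_le.
        { apply dd_bound_ext with (fun u => 1 + - (q ^ S n) * f u); [intros u; simpl; ring|].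
          apply dd_bound_plus; [apply dd_bound_const|].
          apply dd_bound_mult; [apply dd_bound_const|exact H]. }
        rewrite Cmod_1, Cmod_opp, Cmod_pow, (Rmult_comm _ M); apply exp_ineq1_le.
    + apply exp_le_compat, Rmult_le_compat_l; auto; apply geom_sum_le; auto.
  - intros u; apply Eul_cv; auto.
Qed.

Lemma smooth_const (k : C) : smooth (fun _ => k).
Proof.
  intros r; eexists; apply dd_bound_const.
Qed.

Lemma smooth_id : smooth (fun u => u).
Proof.
  intros r; destruct (Rle_lt_dec 0 r) as [H|H].
  - exists (r + 1)%R; apply dd_bound_id; auto.
  - exists 0%R, 0%R, 0%R, 0%R; split; [lra|].
    intros u v w Hu; pose proof (Cmod_ge_0 u); lra.
Qed.

Lemma smooth_plus (f g : C -> C) : smooth f -> smooth g -> smooth (fun u => f u + g u).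
Proof.
  intros Hf Hg r; destruct (Hf r) as [M H], (Hg r) as [N K].
  exists (M + N)%R; apply dd_bound_plus; auto.
Qed.

Lemma smooth_mult (f g : C -> C) : smooth f -> smooth g -> smooth (fun u => f u * g u).
Proof.
  intros Hf Hg r; destruct (Hf r) as [M H], (Hg r) as [N K].
  exists (M * N)%R; apply dd_bound_mult; auto.
Qed.

Lemma smooth_Cexp (f : C -> C) : smooth f -> smooth (fun u => Cexp (f u)).
Proof.
  intros Hf r; destruct (Hf r) as [M H]; eexists; apply dd_bound_Cexp; eauto.
Qed.

Lemma smooth_Eul (q : C) (f : C -> C) :
  (Cmod q < 1)%R -> smooth f -> smooth (fun u => Eul q (f u)).
Proof.
  intros Hq Hf r; destruct (Hf r) as [M H]; eexists; apply dd_bound_Eul; eauto.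
Qed.

Lemma smooth_ext (f g : C -> C) : (forall u, f u = g u) -> smooth f -> smooth g.
Proof.
  intros E H r; destruct (H r) as [M K]; exists M; eapply dd_bound_ext; eauto.
Qed.

(** * Means over equidistant points *)

Definition e1 (z : C) : C := Cexp (2 * (PI * Ci) * z).

Lemma e1_plus (z w : C) : e1 (z + w) = e1 z * e1 w.
Proof.
  unfold e1; rewrite <- Cexp_plus; f_equal; ring.
Qed.

Lemma e1_IZR (k : Z) : e1 (IZR k) = 1.
Proof.
  unfold e1; rewrite Cmult_comm; apply Cexp_2PI_IZR.
Qed.

Lemma e1_0 : e1 0 = 1.
Proof.
  apply (e1_IZR 0).
Qed.

Lemma e1_neq_0 (z : C) : e1 z <> 0.
Proof.
  apply Cexp_neq_0.
Qed.

Lemma e1_half : e1 (/ 2) = - (1).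
Proof.
  unfold e1; rewrite <- Cexp_PI; f_equal; field.
Qed.

Lemma e1_R (x : R) : e1 x = (cos (2 * PI * x), sin (2 * PI * x)).
Proof.
  unfold e1; rewrite <- Cexp_Im, !RtoC_mult; f_equal; ring.
Qed.

Lemma Cmod_e1_R (x : R) : Cmod (e1 x) = 1%R.
Proof.
  rewrite e1_R; unfold Cmod; simpl.
  replace (_ + _)%R with (Rsqr (sin (2 * PI * x)) + Rsqr (cos (2 * PI * x)))%R
    by (unfold Rsqr; ring).
  rewrite sin2_cos2; apply sqrt_1.
Qed.

Lemma smooth_e1 (f : C -> C) : smooth f -> smooth (fun u => e1 (f u)).
Proof.
  intros H; apply smooth_Cexp, smooth_mult; auto; apply smooth_const.
Qed.

Fixpoint Csum (f : nat -> C) (m : nat) : C :=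
  match m with
  | O => 0
  | S k => Csum f k + f k
  end.

Lemma Csum_ext (f g : nat -> C) (m : nat) :
  (forall j, (j < m)%nat -> f j = g j) -> Csum f m = Csum g m.
Proof.
  intros H; induction m as [|m IH]; simpl; [reflexivity|].
  rewrite IH, H by auto; reflexivity.
Qed.

Lemma Csum_plus (f g : nat -> C) (m : nat) :
  Csum (fun j => f j + g j) m = Csum f m + Csum g m.
Proof.
  induction m as [|m IH]; simpl; [|rewrite IH]; ring.
Qed.

Lemma Csum_scal (k : C) (f : nat -> C) (m : nat) :
  Csum (fun j => k * f j) m = k * Csum f m.
Proof.
  induction m as [|m IH]; simpl; [|rewrite IH]; ring.
Qed.

Lemma Csum_exchange (f : nat -> nat -> C) (m n : nat) :
  Csum (fun i => Csum (f i) n) m = Csum (fun j => Csum (fun i => f i j) m) n.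
Proof.
  induction m as [|m IH]; simpl.
  - induction n as [|n IHn]; simpl; [|rewrite <- IHn]; ring.
  - rewrite IH, <- Csum_plus; reflexivity.
Qed.

Lemma Csum_telescope (f : nat -> C) (m : nat) :
  Csum (fun j => f (S j) - f j) m = f m - f O.
Proof.
  induction m as [|m IH]; simpl; [|rewrite IH]; ring.
Qed.

Lemma Csum_shift (f : nat -> C) (m : nat) :
  Csum (fun j => f (S j)) m = Csum f m + (f m - f O).
Proof.
  induction m as [|m IH]; simpl; [|rewrite IH]; ring.
Qed.

Lemma Cmod_Csum_le (f : nat -> C) (B : R) (m : nat) :
  (forall j, (j < m)%nat -> (Cmod (f j) <= B)%R) -> (Cmod (Csum f m) <= INR m * B)%R.
Proof.
  intros H; induction m as [|m IH].
  - simpl; rewrite Cmod_0; lra.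
  - rewrite S_INR; simpl.
    eapply Rle_trans; [apply Cmod_triangle|].
    assert (H1 := H m (Nat.lt_succ_diag_r m)).
    assert (H2 := IH (fun j Hj => H j (Nat.lt_lt_succ_r _ _ Hj))).
    rewrite Rmult_plus_distr_r, Rmult_1_l; apply Rplus_le_compat; auto.
Qed.

Lemma Csum_single (f : nat -> C) (m : nat) :
  (forall j, (0 < j < S m)%nat -> f j = 0) -> Csum f (S m) = f O.
Proof.
  intros H; induction m as [|m IH].
  - simpl; ring.
  - change (Csum f (S (S m))) with (Csum f (S m) + f (S m)).
    rewrite IH, (H (S m)) by (lia || (intros; apply H; lia)); ring.
Qed.

(** Riemann sum for $\int_0^1 f(u+x)\,dx$; the successor keeps the number of nodes positive. *)
Definition mean (n : nat) (f : C -> C) (u : C) : C :=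
  / INR (S n) * Csum (fun j => f (u + (INR j / INR (S n))%R)) (S n).

Lemma INR_S_pos (n : nat) : (0 < INR (S n))%R.
Proof.
  apply (lt_INR 0); lia.
Qed.

Lemma RtoC_INR_S_neq_0 (n : nat) : RtoC (INR (S n)) <> 0.
Proof.
  intros E; apply RtoC_inj in E; pose proof (INR_S_pos n); lra.
Qed.

Lemma mean_ext (n : nat) (f g : C -> C) (u : C) :
  (forall z, f z = g z) -> mean n f u = mean n g u.
Proof.
  intros H; unfold mean; f_equal; apply Csum_ext; intros; apply H.
Qed.

Lemma mean_plus (n : nat) (f g : C -> C) (u : C) :
  mean n (fun z => f z + g z) u = mean n f u + mean n g u.
Proof.
  unfold mean; rewrite Csum_plus; ring.
Qed.

Lemma mean_scal (n : nat) (k : C) (f : C -> C) (u : C) :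
  mean n (fun z => k * f z) u = k * mean n f u.
Proof.
  unfold mean; rewrite Csum_scal; ring.
Qed.

Lemma mean_translate (n : nat) (f : C -> C) (u w : C) :
  mean n (fun z => f (z + w)) u = mean n f (u + w).
Proof.
  unfold mean; f_equal; apply Csum_ext; intros; f_equal; ring.
Qed.

Lemma Cmod_mean_le (n : nat) (f : C -> C) (u : C) (B : R) :
  (forall j, (j < S n)%nat -> (Cmod (f (u + (INR j / INR (S n))%R)%C) <= B)%R) ->
  (Cmod (mean n f u) <= B)%R.
Proof.
  intros H; assert (P := INR_S_pos n).
  unfold mean; rewrite Cmod_mult, Cmod_inv by apply RtoC_INR_S_neq_0.
  rewrite Cmod_R, Rabs_pos_eq by lra.
  apply Rmult_le_reg_l with (INR (S n)); auto.
  rewrite <- Rmult_assoc, Rinv_r, Rmult_1_l by lra.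
  apply Cmod_Csum_le; auto.
Qed.

(** A shift by one node spacing permutes the nodes cyclically modulo the period. *)
Lemma mean_step (n : nat) (f : C -> C) (u : C) :
  (forall z, f (z + 1) = f z) -> mean n f (u + (/ INR (S n))%R) = mean n f u.
Proof.
  intros H; unfold mean; f_equal.
  assert (P := INR_S_pos n).
  set (F := fun j => f (u + (INR j / INR (S n))%R)).
  transitivity (Csum (fun j => F (S j)) (S n)).
  - apply Csum_ext; intros j _; unfold F; f_equal.
    rewrite <- Cplus_assoc, <- RtoC_plus; do 2 f_equal.
    rewrite (S_INR j); field; lra.
  - rewrite Csum_shift.
    replace (F (S n)) with (F O); [ring|unfold F].
    rewrite <- H; f_equal.
    rewrite <- Cplus_assoc, <- RtoC_plus; do 2 f_equal.
    change (INR 0) with 0%R; field; lra.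
Qed.

Lemma Cmod_shift_le (z : C) (j n : nat) : (j <= S n)%nat ->
  (Cmod (z + (INR j / INR (S n))%R)%C <= Cmod z + 1)%R.
Proof.
  intros H; assert (P := INR_S_pos n).
  eapply Rle_trans; [apply Cmod_triangle|].
  rewrite Cmod_R, Rabs_pos_eq.
  - apply Rplus_le_compat_l, Rle_div_l; [lra|]; rewrite Rmult_1_l; apply le_INR; auto.
  - apply Rdiv_le_0_compat; auto; apply pos_INR.
Qed.

(* Moving from [0] to [u] in [n + 1] steps, each step changes the mean by
   [O(1/n^2)]: to first order the change is [u] times the change under a shift
   by [1/(n+1)], which vanishes. *)
Lemma mean_almost_constant (f : C -> C) (u : C) :
  smooth f -> (forall z, f (z + 1) = f z) ->
  exists B, forall n, (Cmod (mean n f u - mean n f 0)%C <= B / INR (S n))%R.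
Proof.
  intros Hs Hp.
  destruct (Hs (Cmod u + 2)%R) as (M & a & b & c & Hc & K).
  exists (c * (Cmod u * Cmod (u - 1)))%R; intros n.
  assert (P := INR_S_pos n); assert (P' := RtoC_INR_S_neq_0 n).
  set (h := (/ INR (S n))%R).
  assert (Ph : (0 < h)%R) by (apply Rinv_0_lt_compat; auto).
  assert (Hh1 : (h <= 1)%R).
  { unfold h; rewrite <- Rinv_1; apply Rinv_le_contravar; [lra|apply (le_INR 1); lia]. }
  set (U := fun l : nat => (INR l * h)%R * u).
  assert (U1 : U (S n) = u).
  { unfold U, h; rewrite Rinv_r by lra; ring. }
  assert (U0 : U O = 0) by (unfold U; simpl; rewrite Rmult_0_l; ring).
  replace (mean n f u - mean n f 0) with (mean n f (U (S n)) - mean n f (U O))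
    by (rewrite U1, U0; reflexivity).
  rewrite <- (Csum_telescope (fun l => mean n f (U l)) (S n)).
  apply Rle_trans with (INR (S n) * (c * h ^ 2 * (Cmod u * Cmod (u - 1))))%R;
    [|right; unfold h; field; lra].
  apply Cmod_Csum_le; intros l Hl.
  assert (E1 : U (S l) = U l + h * u).
  { unfold U; rewrite S_INR, !RtoC_mult, RtoC_plus; ring. }
  rewrite E1, <- (mean_translate n f (U l) (h * u)).
  (* Subtracting $u$ times this zero leaves summands $f(z+hu)-f(z)-u(f(z+h)-f(z))$, which have no
     first-order part. *)
  assert (Z : mean n (fun z => f (z + h) + - (1) * f z) (U l) = 0).
  { rewrite mean_plus, mean_scal, mean_translate; unfold h; rewrite mean_step by auto; ring. }
  replace (mean n (fun z => f (z + h * u)) (U l) - mean n f (U l)) with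
    (mean n (fun z => f (z + h * u) + - (1) * f z + - u * (f (z + h) + - (1) * f z)) (U l)).
  2:{ rewrite mean_plus, mean_scal, Z, mean_plus, mean_scal; ring. }
  apply Cmod_mean_le; intros j Hj.
  set (z := U l + (INR j / INR (S n))%R).
  assert (HU : (Cmod (U l) <= Cmod u)%R).
  { unfold U; rewrite Cmod_mult, Cmod_R, Rabs_pos_eq
      by (apply Rmult_le_pos; [apply pos_INR|lra]).
    assert (INR l * h <= 1)%R.
    { unfold h; apply Rle_div_l; [lra|]; rewrite Rmult_1_l; apply le_INR; lia. }
    pose proof (Cmod_ge_0 u); nra. }
  assert (Bz : (Cmod z <= Cmod u + 2)%R).
  { unfold z; eapply Rle_trans; [apply Cmod_shift_le; lia|lra]. }
  assert (Bw : (Cmod (z + h) <= Cmod u + 2)%R).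
  { unfold z; replace (U l + (INR j / INR (S n))%R + h) with
      (U l + (INR (S j) / INR (S n))%R).
    - eapply Rle_trans; [apply Cmod_shift_le; lia|lra].
    - rewrite <- Cplus_assoc, <- RtoC_plus, (S_INR j); do 2 f_equal; unfold h; field; lra. }
  assert (Bv : (Cmod (z + h * u) <= Cmod u + 2)%R).
  { unfold z; replace (U l + (INR j / INR (S n))%R + h * u) with
      (U (S l) + (INR j / INR (S n))%R) by (rewrite E1; ring).
    eapply Rle_trans; [apply Cmod_shift_le; lia|].
    enough (Cmod (U (S l)) <= Cmod u)%R by lra.
    unfold U; rewrite Cmod_mult, Cmod_R, Rabs_pos_eq
      by (apply Rmult_le_pos; [apply pos_INR|lra]).
    assert (INR (S l) * h <= 1)%R.
    { unfold h; apply Rle_div_l; [lra|]; rewrite Rmult_1_l; apply le_INR; lia. }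
    pose proof (Cmod_ge_0 u); nra. }
  (* Cleared of denominators, the second divided difference at these three points is $h$ times the
     summand, against the Vandermonde factor $h^3|u||u-1|$. *)
  destruct (K z (z + h * u) (z + h) Bz Bv Bw) as (_ & _ & D).
  replace (f z * (z + h * u - (z + h)) + f (z + h * u) * (z + h - z) + f (z + h) * (z - (z + h * u)))
    with (h * (f (z + h * u) + - (1) * f z + - u * (f (z + h) + - (1) * f z))) in D by ring.
  replace (z - (z + h * u)) with (- (h * u)) in D by ring.
  replace (z + h * u - (z + h)) with (h * (u - 1)) in D by ring.
  replace (z + h - z) with (RtoC h) in D by ring.
  rewrite Cmod_opp, !Cmod_mult, !Cmod_R, !(Rabs_pos_eq h) in D by lra.
  apply Rmult_le_reg_l with h; auto.
  eapply Rle_trans; [exact D|right; ring].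
Qed.

(** * Discrete Fourier expansion and its exact inversion *)

(** Discretises the whole $k$-th term $\hat g(k)e^{2\pi iku}$ of the Fourier series, not the
    coefficient alone, with $n+1$ nodes that start at $u$ itself. *)
Definition dft (n : nat) (g : C -> C) (k : Z) (u : C) : C :=
  e1 (IZR k * u) * mean n (fun z => g z * e1 (- (IZR k * z))) u.

Lemma dft_expand (n : nat) (g : C -> C) (k : Z) (u : C) :
  dft n g k u = / INR (S n) *
    Csum (fun j => g (u + (INR j / INR (S n))%R) * e1 (- (IZR k * (INR j / INR (S n))%R))) (S n).
Proof.
  unfold dft, mean.
  rewrite Cmult_assoc, (Cmult_comm (e1 _)), <- Cmult_assoc, <- Csum_scal; f_equal.
  apply Csum_ext; intros j _; set (x := RtoC (INR j / INR (S n))).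
  replace (- (IZR k * (u + x))) with (- (IZR k * u) + - (IZR k * x)) by ring.
  rewrite e1_plus.
  transitivity (e1 (IZR k * u) * e1 (- (IZR k * u)) * (g (u + x) * e1 (- (IZR k * x)))); [ring|].
  rewrite <- e1_plus; replace (IZR k * u + - (IZR k * u)) with (RtoC 0) by ring.
  rewrite e1_0; ring.
Qed.

(** A sum over $|k|\le K$, arranged in pairs $\pm k$ so that raising $K$ appends one term of a
    [Csum]. *)
Definition sym_sum (f : Z -> C) (K : nat) : C :=
  f 0%Z + Csum (fun i => f (Z.of_nat (S i)) + f (- Z.of_nat (S i))%Z) K.

Lemma Dirichlet_kernel (z : C) (K : nat) :
  (e1 z - 1) * sym_sum (fun k => e1 (- (IZR k * z))) K =
  e1 (INR (S K) * z) - e1 (- (INR K * z)).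
Proof.
  unfold sym_sum; induction K as [|K IH].
  - simpl Csum.
    replace (- (0 * z)) with (RtoC 0) by ring.
    replace (INR 1 * z) with z by (simpl; ring).
    replace (- (INR 0 * z)) with (RtoC 0) by (simpl; ring).
    rewrite e1_0; ring.
  - change (Csum ?f (S K)) with (Csum f K + f K); cbv beta.
    rewrite Cplus_assoc, Cmult_plus_distr_l, IH.
    rewrite opp_IZR, <- INR_IZR_INZ, RtoC_opp.
    replace (- (- INR (S K) * z)) with (INR (S K) * z) by ring.
    rewrite (S_INR (S K)), RtoC_plus.
    replace ((INR (S K) + 1) * z) with (INR (S K) * z + z) by ring.
    replace (- (INR K * z)) with (- (INR (S K) * z) + z)
      by (rewrite S_INR, RtoC_plus; ring).
    rewrite !e1_plus; ring.
Qed.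

Lemma e1_fraction_neq_1 (j n : nat) : (0 < j < S n)%nat -> e1 (INR j / INR (S n))%R <> 1.
Proof.
  intros H E; rewrite e1_R in E.
  assert (E1 : (cos (2 * PI * (INR j / INR (S n))) = 1)%R) by exact (f_equal fst E).
  assert (P := INR_S_pos n).
  set (x := (PI * (INR j / INR (S n)))%R).
  replace (2 * PI * (INR j / INR (S n)))%R with (2 * x)%R in E1 by (unfold x; ring).
  rewrite cos_2a_sin in E1.
  assert (0 < sin x)%R; [|nra].
  assert (0 < INR j / INR (S n) < 1)%R.
  { split; [apply Rdiv_lt_0_compat; auto; apply (lt_INR 0); lia|].
    apply Rlt_div_l; auto; rewrite Rmult_1_l; apply lt_INR; lia. }
  pose proof PI_RGT_0; apply sin_gt_0; unfold x; nra.
Qed.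

Lemma sym_sum_const (c : C) (K : nat) : sym_sum (fun _ => c) K = INR (S (2 * K)) * c.
Proof.
  unfold sym_sum; induction K as [|K IH].
  - simpl; ring.
  - change (Csum ?f (S K)) with (Csum f K + f K); cbv beta.
    rewrite Cplus_assoc, IH.
    replace (S (2 * S K)) with (S (S (S (2 * K)))) by lia.
    rewrite (S_INR (S (S _))), (S_INR (S (2 * K))), !RtoC_plus; ring.
Qed.

Lemma sym_sum_ext (f g : Z -> C) (K : nat) :
  (forall k, f k = g k) -> sym_sum f K = sym_sum g K.
Proof.
  intros H; unfold sym_sum; rewrite H; f_equal.
  apply Csum_ext; intros; rewrite !H; reflexivity.
Qed.

Lemma sym_sum_scal (c : C) (f : Z -> C) (K : nat) :
  sym_sum (fun k => c * f k) K = c * sym_sum f K.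
Proof.
  unfold sym_sum; rewrite Cmult_plus_distr_l, <- Csum_scal; f_equal.
  apply Csum_ext; intros; ring.
Qed.

Lemma sym_sum_Csum (f : Z -> nat -> C) (K m : nat) :
  sym_sum (fun k => Csum (f k) m) K = Csum (fun j => sym_sum (fun k => f k j) K) m.
Proof.
  unfold sym_sum; rewrite (Csum_plus (f 0%Z)); f_equal.
  rewrite <- (Csum_exchange (fun i j => f (Z.of_nat (S i)) j + f (- Z.of_nat (S i))%Z j)).
  apply Csum_ext; intros; rewrite Csum_plus; reflexivity.
Qed.

(** Exact, because the order [2 * K] means $2K+1$ nodes, as many as there are frequencies $|k|\le
    K$. Exchanging the sums leaves a Dirichlet kernel at each node, which vanishes at every node but
    the first. *)
Lemma dft_inversion (g : C -> C) (K : nat) (u : C) :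
  sym_sum (fun k => dft (2 * K) g k u) K = g u.
Proof.
  set (n := (2 * K)%nat).
  rewrite (sym_sum_ext _ _ K (fun k => dft_expand n g k u)), sym_sum_scal, sym_sum_Csum.
  rewrite (Csum_ext _ (fun j => g (u + (INR j / INR (S n))%R) *
    sym_sum (fun k => e1 (- (IZR k * (INR j / INR (S n))%R))) K))
    by (intros; apply sym_sum_scal).
  assert (P := INR_S_pos n); assert (P' := RtoC_INR_S_neq_0 n).
  rewrite Csum_single.
  - replace (INR 0 / INR (S n))%R with 0%R by (change (INR 0) with 0%R; field; lra).
    rewrite (sym_sum_ext _ (fun _ => 1)).
    + rewrite sym_sum_const, Cplus_0_r; fold n; field; auto.
    + intros k; rewrite Cmult_0_r, Copp_0; apply e1_0.
  - intros j Hj; set (x := (INR j / INR (S n))%R).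
    replace (sym_sum _ K) with (RtoC 0); [ring|symmetry].
    assert (D := Dirichlet_kernel x K).
    (* Since $(2K+1)x=j$, the two exponentials on the right of the kernel identity agree, whereas
       [e1 x] differs from 1. *)
    replace (INR (S K) * x) with (- (INR K * x) + IZR (Z.of_nat j)) in D.
    + rewrite e1_plus, e1_IZR, Cmult_1_r in D.
      assert (N : e1 x - 1 <> 0) by (apply Cminus_eq_contra, e1_fraction_neq_1; auto).
      replace (e1 (- (INR K * x)) - e1 (- (INR K * x))) with (RtoC 0) in D by ring.
      rewrite <- (Cmult_1_l (sym_sum _ K)), <- (Cinv_l _ N), <- Cmult_assoc, D; ring.
    + rewrite <- INR_IZR_INZ, <- !RtoC_mult, <- RtoC_opp, <- RtoC_plus; f_equal.
      unfold x.
      assert (En : INR (S n) = (2 * INR K + 1)%R)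
        by (unfold n; rewrite S_INR, mult_INR; simpl; ring).
      rewrite (S_INR K), En in *; field; lra.
Qed.

(** * Quasi-periodic functions *)

(** In $\sin x=2\sin(x/2)\cos(x/2)$ the mean value theorem gives $\sin(x/2)=(x/2)\cos c$; both
    cosines are at least $\cos(\pi/4)$, whose square is $1/2$. *)
Lemma sin_ge_half (x : R) : (0 <= x <= PI / 2 -> x / 2 <= sin x)%R.
Proof.
  intros [H0 H1].
  assert (HP := PI_RGT_0).
  destruct (MVT_gen sin 0 (x / 2) cos) as (c & Hc & E).
  - intros t _; auto_derive; auto; ring.
  - intros t _; apply continuity_sin.
  - rewrite sin_0, !Rminus_0_r in E.
    rewrite Rmin_left, Rmax_right in Hc by lra.
    assert (C1 : (cos (PI / 4) <= cos c)%R) by (apply cos_decr_1; lra).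
    assert (C2 : (cos (PI / 4) <= cos (x / 2))%R) by (apply cos_decr_1; lra).
    assert (S2 : (cos (PI / 4) * cos (PI / 4) = 1 / 2)%R).
    { rewrite cos_PI4; assert (H2 := sqrt_sqrt 2 ltac:(lra)).
      assert (H3 := sqrt_lt_R0 2 ltac:(lra)); field_simplify; [|lra].
      rewrite <- Rsqr_pow2, Rsqr_sqrt by lra; field. }
    assert (C0 : (0 < cos (PI / 4))%R) by (apply cos_gt_0; lra).
    replace x with (2 * (x / 2))%R at 2 by field.
    rewrite sin_2a, E.
    assert (1 / 2 <= cos c * cos (x / 2))%R
      by (rewrite <- S2; apply Rmult_le_compat; lra).
    nra.
Qed.

(** The quantity is $-4\sin^2(\pi x)$, the multiplier of a second difference on a pure frequency;
    [dft_decay] divides by it. *)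
Lemma e1_second_difference_ge (x : R) : (Rabs x <= / 2)%R ->
  (x ^ 2 <= Cmod (e1 x + - (2) + e1 (- x)))%R.
Proof.
  intros H.
  rewrite <- (RtoC_opp x), !e1_R.
  replace (2 * PI * - x)%R with (- (2 * PI * x))%R by ring.
  rewrite cos_neg, sin_neg.
  replace (_ + _ + _) with (RtoC (- (4 * sin (PI * x) ^ 2))%R).
  2:{ replace (2 * PI * x)%R with (2 * (PI * x))%R by ring.
      apply injective_projections; simpl; [rewrite cos_2a_sin|]; ring. }
  rewrite Cmod_R, Rabs_Ropp, Rabs_pos_eq by (pose proof (pow2_ge_0 (sin (PI * x))); lra).
  assert (HP := PI2_1); assert (X := Rabs_pos x).
  assert (K : (Rabs x / 2 <= Rabs (sin (PI * x)))%R).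
  { assert (S1 := sin_ge_half (PI * Rabs x) ltac:(split; nra)).
    eapply Rle_trans; [|eapply Rle_trans; [exact S1|]]; [nra|].
    destruct (Rle_lt_dec 0 x) as [L|L].
    - rewrite (Rabs_pos_eq x) by auto; apply Rle_abs.
    - rewrite (Rabs_left x), Ropp_mult_distr_r_reverse, sin_neg by auto.
      rewrite <- Rabs_Ropp; apply Rle_abs. }
  rewrite <- (pow2_abs x), <- (pow2_abs (sin _)); nra.
Qed.

(** Discrete double integration by parts: the second difference of $g$ with step $h$ is $O(h^2)$,
    and on the $k$-th term it acts as $e^{2\pi ikh}-2+e^{-2\pi ikh}$, of size at least $(kh)^2$.
    Uniformity in $K$ is what the truncation in [quasi_periodic_approx] needs. *)
Lemma dft_decay (g : C -> C) (u : C) :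
  smooth g -> (forall z, g (z + 1) = g z) ->
  exists B, (0 <= B)%R /\ forall (K : nat) (k : Z), (1 <= Z.abs k <= Z.of_nat K)%Z ->
    (IZR k ^ 2 * Cmod (dft (2 * K) g k u) <= B)%R.
Proof.
  intros Hs Hp.
  destruct (Hs (Cmod u + 2)%R) as (M & a & b & c & Hc & D).
  exists (2 * c)%R; split; [lra|].
  intros K k Hk; set (n := (2 * K)%nat).
  assert (P := INR_S_pos n).
  set (h := (/ INR (S n))%R).
  assert (Ph : (0 < h)%R) by (apply Rinv_0_lt_compat; auto).
  assert (Hh1 : (h <= 1)%R).
  { unfold h; rewrite <- Rinv_1; apply Rinv_le_contravar; [lra|apply (le_INR 1); lia]. }
  (* Here $h=1/(2K+1)$ and $|k|\le K$ are used. *)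
  assert (Hkh : (Rabs (IZR k * h) <= / 2)%R).
  { rewrite Rabs_mult, (Rabs_pos_eq h), <- abs_IZR by lra.
    apply Rle_div_l; [lra|].
    apply Rle_trans with (INR K).
    - rewrite INR_IZR_INZ; apply IZR_le; lia.
    - unfold n; rewrite S_INR, mult_INR; simpl; lra. }
  set (phi := fun z => g z * e1 (- (IZR k * z))).
  assert (Hphi : forall z, phi (z + 1) = phi z).
  { intros z; unfold phi; rewrite Hp.
    replace (- (IZR k * (z + 1))) with (- (IZR k * z) + IZR (- k))
      by (rewrite opp_IZR, RtoC_opp; ring).
    rewrite e1_plus, e1_IZR; ring. }
  assert (Eq : (e1 (IZR k * h)%R + - (2) + e1 (- (IZR k * h)%R)) * dft n g k u =
    e1 (IZR k * u) * mean n (fun z => e1 (- (IZR k * z)) *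
      (g (z + h) + - (2) * g z + g (z + - h))) u).
  { unfold dft; fold phi.
    set (m := mean n phi u).
    assert (M1 : mean n (fun z => phi (z + h)) u = m).
    { rewrite mean_translate; apply mean_step; auto. }
    assert (M2 : mean n (fun z => phi (z + - h)) u = m).
    { rewrite mean_translate; unfold m; rewrite <- (mean_step n phi (u + - h)) by auto.
      f_equal; fold h; ring. }
    rewrite (mean_ext n _ (fun z => e1 (IZR k * h)%R * phi (z + h) + - (2) * phi z +
      e1 (- (IZR k * h)%R) * phi (z + - h))).
    - rewrite !mean_plus, !mean_scal, M1, M2; fold m; ring.
    - intros z; unfold phi; rewrite RtoC_mult.
      replace (- (IZR k * (z + h))) with (- (IZR k * z) + - (IZR k * h)) by ring.
      replace (- (IZR k * (z + - h))) with (- (IZR k * z) + IZR k * h) by ring.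
      assert (I : e1 (IZR k * h) * e1 (- (IZR k * h)) = 1).
      { rewrite <- e1_plus, <- e1_0; f_equal; ring. }
      rewrite !e1_plus.
      transitivity (e1 (- (IZR k * z)) * ((e1 (IZR k * h) * e1 (- (IZR k * h))) * g (z + h) +
        - (2) * g z + (e1 (IZR k * h) * e1 (- (IZR k * h))) * g (z + - h))); [|ring].
      rewrite I; ring. }
  assert (Bd : (Cmod (e1 (IZR k * u) * mean n (fun z => e1 (- (IZR k * z)) *
      (g (z + h) + - (2) * g z + g (z + - h))) u)%C <= 2 * c * h ^ 2)%R).
  { rewrite <- mean_scal; apply Cmod_mean_le; intros j Hj.
    set (z := u + (INR j / INR (S n))%R).
    rewrite Cmult_assoc, <- e1_plus.
    replace (IZR k * u + - (IZR k * z)) with (RtoC (- (IZR k * (INR j / INR (S n))))%R)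
      by (unfold z; rewrite RtoC_opp, RtoC_mult; ring).
    rewrite Cmod_mult, Cmod_e1_R, Rmult_1_l.
    assert (Bz : (Cmod z <= Cmod u + 1)%R) by (apply Cmod_shift_le; lia).
    assert (Bv : (Cmod (z + h) <= Cmod u + 2)%R).
    { eapply Rle_trans; [apply Cmod_triangle|]; rewrite Cmod_R, Rabs_pos_eq; lra. }
    assert (Bw : (Cmod (z + - h) <= Cmod u + 2)%R).
    { eapply Rle_trans; [apply Cmod_triangle|]; rewrite Cmod_opp, Cmod_R, Rabs_pos_eq; lra. }
    (* The Vandermonde factor of $z,z+h,z-h$ is $2h^3$, which explains the constant $2c$. *)
    destruct (D z (z + h) (z + - h) ltac:(lra) Bv Bw) as (_ & _ & D3).
    replace (g z * (z + h - (z + - h)) + g (z + h) * (z + - h - z) + g (z + - h) * (z - (z + h)))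
      with (- (h * (g (z + h) + - (2) * g z + g (z + - h)))) in D3 by ring.
    replace (z - (z + h)) with (- RtoC h) in D3 by ring.
    replace (z + h - (z + - h)) with (2 * h) in D3 by ring.
    replace (z + - h - z) with (- RtoC h) in D3 by ring.
    rewrite !Cmod_opp, !Cmod_mult, !Cmod_R, !(Rabs_pos_eq h), (Rabs_pos_eq 2) in D3 by lra.
    apply Rmult_le_reg_l with h; auto.
    eapply Rle_trans; [exact D3|right; ring]. }
  rewrite <- Eq, Cmod_mult in Bd.
  assert (S2 := e1_second_difference_ge _ Hkh).
  apply Rmult_le_reg_l with (h ^ 2)%R; [apply pow_lt; auto|].
  eapply Rle_trans; [|eapply Rle_trans; [exact Bd|right; ring]].
  rewrite <- Rmult_assoc; apply Rmult_le_compat_r; [apply Cmod_ge_0|].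
  eapply Rle_trans; [|exact S2]; right; ring.
Qed.

(** The tail telescopes, since $1/x^2\le 2(1/x-1/(x+1))$ for $x\ge1$. *)
Lemma Cmod_tail_le (f : nat -> C) (B : R) (L d : nat) : (0 <= B)%R ->
  (forall i, (i < L + d)%nat -> (INR (S i) ^ 2 * Cmod (f i) <= B)%R) ->
  (Cmod (Csum f (L + d) - Csum f L) <= 2 * B * (/ INR (S L) - / INR (S (L + d))))%R.
Proof.
  intros HB H; induction d as [|d IH].
  - rewrite Nat.add_0_r; replace (Csum f L - Csum f L) with (RtoC 0) by ring.
    rewrite Cmod_0; lra.
  - replace (L + S d)%nat with (S (L + d)) in * by lia.
    simpl Csum.
    replace (Csum f (L + d) + f (L + d)%nat - Csum f L) with
      ((Csum f (L + d) - Csum f L) + f (L + d)%nat) by ring.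
    eapply Rle_trans; [apply Cmod_triangle|].
    assert (H1 := IH (fun i Hi => H i (Nat.lt_lt_succ_r _ _ Hi))).
    assert (H2 := H (L + d)%nat (Nat.lt_succ_diag_r _)).
    assert (P := INR_S_pos (L + d)).
    assert (P1 : (1 <= INR (S (L + d)))%R) by (apply (le_INR 1); lia).
    rewrite (S_INR (S (L + d))).
    set (x := INR (S (L + d))) in *; set (y := Cmod (f (L + d)%nat)) in *.
    assert (H3 : (y <= 2 * B * (/ x - / (x + 1)))%R); [|lra].
    replace (2 * B * (/ x - / (x + 1)))%R with (2 * B / (x * (x + 1)))%R by (field; lra).
    apply Rle_div_r; [nra|].
    assert (Y := Cmod_ge_0 (f (L + d)%nat)); fold y in Y; nra.
Qed.

(** The term $(-1)^kq^{k(k-1)/2}t^k$ of the theta series with multiplier $-t^{-1}$ under $u\mapsto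
    u+\tau$; the sign is written $e^{-\pi ik}$. *)
Definition theta_coef (tau : C) (k : Z) (u : C) : C :=
  e1 (IZR k * u - IZR k / 2 + tau * (IZR k * (IZR k - 1) / 2)).

Lemma quasi_period_iter (g : C -> C) (tau : C) :
  (forall z, g (z + tau) = - e1 (- z) * g z) ->
  forall (k : Z) (z : C),
    g (z + IZR k * tau) = e1 (IZR k / 2 - IZR k * z - tau * (IZR k * (IZR k - 1) / 2)) * g z.
Proof.
  intros H k.
  assert (Q : forall z, g (z + tau) = e1 (/ 2 - z) * g z).
  { intros z; rewrite H; unfold Cminus; rewrite e1_plus, e1_half; ring. }
  assert (Step : forall (k : Z) z, g (z + IZR (Z.succ k) * tau) =
    e1 (/ 2 - (z + IZR k * tau)) * g (z + IZR k * tau)).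
  { intros j z; rewrite <- Q; f_equal; rewrite succ_IZR, RtoC_plus; ring. }
  assert (Exp : forall (k : Z) z, e1 (IZR (Z.succ k) / 2 - IZR (Z.succ k) * z -
      tau * (IZR (Z.succ k) * (IZR (Z.succ k) - 1) / 2)) =
    e1 (/ 2 - (z + IZR k * tau)) * e1 (IZR k / 2 - IZR k * z - tau * (IZR k * (IZR k - 1) / 2))).
  { intros j z; rewrite <- e1_plus; f_equal; rewrite succ_IZR, RtoC_plus; field. }
  pattern k; apply Z.bi_induction; clear k.
  - intros x y ->; tauto.
  - intros z; replace (z + 0 * tau) with z by ring.
    replace (0 / 2 - 0 * z - tau * (0 * (0 - 1) / 2)) with (RtoC 0) by field.
    rewrite e1_0; ring.
  - intros k; split; intros IH z.
    + rewrite Step, Exp, IH; ring.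
    + specialize (IH z); rewrite Step, Exp in IH.
      assert (N := e1_neq_0 (/ 2 - (z + IZR k * tau))).
      set (w := e1 (/ 2 - (z + IZR k * tau))) in *.
      replace (g (z + IZR k * tau)) with (/ w * (w * g (z + IZR k * tau))) by (field; auto).
      rewrite IH; field; auto.
Qed.

(** The twist by $e^{-2\pi ikz}$ is what $k$ quasi-periods produce, so the $k$-th term is an
    untwisted mean at a shifted base point, and [mean_almost_constant] compares it with the mean at
    0. *)
Lemma dft_quasi_period (g : C -> C) (tau : C) (n : nat) (k : Z) (u : C) :
  (forall z, g (z + tau) = - e1 (- z) * g z) ->
  dft n g k u = theta_coef tau k u * mean n g (u + IZR k * tau).
Proof.
  intros H; unfold dft, theta_coef.
  rewrite <- mean_translate, <- !mean_scal; apply mean_ext; intros z.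
  rewrite (quasi_period_iter g tau H).
  transitivity (e1 (IZR k * u) * e1 (- (IZR k * z)) * g z); [ring|].
  rewrite Cmult_assoc, <- !e1_plus; do 2 f_equal; field.
Qed.

Lemma dft_near_mean (g : C -> C) (tau : C) (k : Z) (u : C) :
  smooth g -> (forall z, g (z + 1) = g z) -> (forall z, g (z + tau) = - e1 (- z) * g z) ->
  exists B, forall n, (Cmod (dft n g k u - theta_coef tau k u * mean n g 0) <= B / INR (S n))%R.
Proof.
  intros Hs Hp Hq.
  destruct (mean_almost_constant g (u + IZR k * tau) Hs Hp) as [B HB].
  exists (Cmod (theta_coef tau k u) * B)%R; intros n.
  rewrite (dft_quasi_period g tau) by auto.
  replace (theta_coef tau k u * mean n g (u + IZR k * tau) - theta_coef tau k u * mean n g 0)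
    with (theta_coef tau k u * (mean n g (u + IZR k * tau) - mean n g 0)) by ring.
  rewrite Cmod_mult; unfold Rdiv; rewrite Rmult_assoc.
  apply Rmult_le_compat_l; [apply Cmod_ge_0|apply HB].
Qed.

Lemma sym_sum_near (f g : nat -> Z -> C) (L : nat) :
  (forall k, exists B, forall n, (Cmod (f n k - g n k) <= B / INR (S n))%R) ->
  exists B, forall n, (Cmod (sym_sum (f n) L - sym_sum (g n) L) <= B / INR (S n))%R.
Proof.
  intros H; unfold sym_sum; induction L as [|L [B IH]].
  - destruct (H 0%Z) as [B HB]; exists B; intros n; simpl.
    replace (f n 0%Z + 0 - (g n 0%Z + 0)) with (f n 0%Z - g n 0%Z) by ring; auto.
  - destruct (H (Z.of_nat (S L))) as [B1 H1], (H (- Z.of_nat (S L))%Z) as [B2 H2].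
    exists (B + (B1 + B2))%R; intros n; specialize (IH n).
    change (Csum ?F (S L)) with (Csum F L + F L); cbv beta.
    set (x := f n 0%Z + Csum (fun i => f n (Z.of_nat (S i)) + f n (- Z.of_nat (S i))%Z) L) in *.
    set (y := g n 0%Z + Csum (fun i => g n (Z.of_nat (S i)) + g n (- Z.of_nat (S i))%Z) L) in *.
    rewrite !Cplus_assoc; fold x y.
    match goal with |- (Cmod ?t <= _)%R => replace t with ((x - y) +
      ((f n (Z.of_nat (S L)) - g n (Z.of_nat (S L))) +
       (f n (- Z.of_nat (S L))%Z - g n (- Z.of_nat (S L))%Z))) end.
    2:{ unfold x, y; ring. }
    eapply Rle_trans; [apply Cmod_triangle|].
    eapply Rle_trans; [apply Rplus_le_compat_l, Cmod_triangle|].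
    specialize (H1 n); specialize (H2 n).
    unfold Rdiv in *; rewrite !Rmult_plus_distr_r; lra.
Qed.

(** First $L$ cuts the tail, by the decay that is uniform in $K$; then $K$ is taken large in terms
    of $L$, because the error of [dft_near_mean] depends on $k$. The bounds hold from some $L_0$ and
    $K_0$ on, so that several functions and points can share $L$ and $K$. *)
Lemma quasi_periodic_approx (g : C -> C) (tau u : C) (eps : R) :
  smooth g -> (forall z, g (z + 1) = g z) -> (forall z, g (z + tau) = - e1 (- z) * g z) ->
  (0 < eps)%R ->
  exists L0, forall L, (L0 <= L)%nat -> exists K0, forall K, (K0 <= K)%nat ->
    (Cmod (g u - mean (2 * K) g 0 * sym_sum (fun k => theta_coef tau k u) L) <= eps)%R.
Proof.
  intros Hs Hp Hq He.
  destruct (dft_decay g u Hs Hp) as (B & HB & Hd).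
  assert (Hlim : forall k : R, exists N, forall n, (N <= n)%nat -> (k / INR (S n) <= eps / 2)%R).
  { intros k; assert (Hk := is_lim_seq_div_S k); apply is_lim_seq_spec in Hk.
    destruct (Hk (mkposreal (eps / 2) ltac:(lra))) as [N HN].
    exists N; intros n Hn; specialize (HN n Hn); simpl pos in HN.
    rewrite Rminus_0_r in HN; apply Rabs_def2 in HN; lra. }
  (* The pair $\pm k$ decays with constant $2B$, and [Cmod_tail_le] doubles it. *)
  destruct (Hlim (4 * B)%R) as [L0 HL0].
  exists L0; intros L HL.
  destruct (sym_sum_near (fun n k => dft n g k u)
    (fun n k => mean n g 0 * theta_coef tau k u) L) as [B' HB'].
  { intros k; destruct (dft_near_mean g tau k u Hs Hp Hq) as [B' HB'].
    exists B'; intros n; rewrite (Cmult_comm (mean n g 0)); apply HB'. }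
  destruct (Hlim B') as [K0 HK0].
  exists (K0 + L)%nat; intros K HK.
  set (n := (2 * K)%nat).
  replace (g u - mean n g 0 * sym_sum (fun k => theta_coef tau k u) L) with
    ((sym_sum (fun k => dft n g k u) K - sym_sum (fun k => dft n g k u) L) +
     (sym_sum (fun k => dft n g k u) L - sym_sum (fun k => mean n g 0 * theta_coef tau k u) L)).
  2:{ unfold n; rewrite dft_inversion, sym_sum_scal; ring. }
  eapply Rle_trans; [apply Cmod_triangle|].
  assert (T1 : (Cmod (sym_sum (fun k => dft n g k u) L -
      sym_sum (fun k => mean n g 0 * theta_coef tau k u) L)%C <= eps / 2)%R).
  { eapply Rle_trans; [apply HB'|apply HK0; unfold n; lia]. }
  enough (T2 : (Cmod (sym_sum (fun k => dft n g k u) K -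
      sym_sum (fun k => dft n g k u) L) <= eps / 2)%R) by lra.
  unfold sym_sum.
  set (F := fun i => dft n g (Z.of_nat (S i)) u + dft n g (- Z.of_nat (S i)) u).
  replace (dft n g 0 u + Csum F K - (dft n g 0 u + Csum F L)) with (Csum F K - Csum F L) by ring.
  replace K with (L + (K - L))%nat by lia.
  eapply Rle_trans; [apply (Cmod_tail_le F (2 * B)); [lra|]|].
  - intros i Hi; unfold F.
    assert (D1 := Hd K (Z.of_nat (S i)) ltac:(lia)).
    assert (D2 := Hd K (- Z.of_nat (S i))%Z ltac:(lia)).
    fold n in D1, D2.
    rewrite opp_IZR in D2; rewrite <- INR_IZR_INZ in D1, D2.
    replace ((- INR (S i)) ^ 2)%R with (INR (S i) ^ 2)%R in D2 by ring.
    eapply Rle_trans; [apply Rmult_le_compat_l; [apply pow2_ge_0|apply Cmod_triangle]|]; lra.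
  - assert (H1 := HL0 L HL).
    assert (P := Rinv_0_lt_compat _ (INR_S_pos (L + (K - L)))).
    unfold Rdiv in *; nra.
Qed.

(** At $u$ and $v$, $f$ is close to $as,at$ and $g$ to $bs,bt$, with the same truncated theta sums
    $s,t$; the products $as\cdot bt$ and $at\cdot bs$ cancel. The cross-multiplied form involves no
    division and allows zero functions. *)
Lemma quasi_periodic_unique (f g : C -> C) (tau u v : C) :
  smooth f -> (forall z, f (z + 1) = f z) -> (forall z, f (z + tau) = - e1 (- z) * f z) ->
  smooth g -> (forall z, g (z + 1) = g z) -> (forall z, g (z + tau) = - e1 (- z) * g z) ->
  f u * g v = f v * g u.
Proof.
  intros fs fp fq gs gp gq.
  set (B := (Cmod (f u) + Cmod (f v) + Cmod (g u) + Cmod (g v) + 2)%R).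
  assert (HB : (2 <= B)%R).
  { unfold B; pose proof (Cmod_ge_0 (f u)); pose proof (Cmod_ge_0 (f v));
    pose proof (Cmod_ge_0 (g u)); pose proof (Cmod_ge_0 (g v)); lra. }
  assert (Key : forall eps, (0 < eps <= 1)%R -> (Cmod (f u * g v - f v * g u) <= eps * B)%R).
  { intros eps He.
    destruct (quasi_periodic_approx f tau u eps fs fp fq (proj1 He)) as [L1 H1].
    destruct (quasi_periodic_approx f tau v eps fs fp fq (proj1 He)) as [L2 H2].
    destruct (quasi_periodic_approx g tau u eps gs gp gq (proj1 He)) as [L3 H3].
    destruct (quasi_periodic_approx g tau v eps gs gp gq (proj1 He)) as [L4 H4].
    set (L := (L1 + L2 + L3 + L4)%nat).
    destruct (H1 L ltac:(lia)) as [K1 G1], (H2 L ltac:(lia)) as [K2 G2],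
      (H3 L ltac:(lia)) as [K3 G3], (H4 L ltac:(lia)) as [K4 G4].
    set (K := (K1 + K2 + K3 + K4)%nat).
    specialize (G1 K ltac:(lia)); specialize (G2 K ltac:(lia));
    specialize (G3 K ltac:(lia)); specialize (G4 K ltac:(lia)).
    set (a := mean (2 * K) f 0) in *; set (b := mean (2 * K) g 0) in *.
    set (s := sym_sum (fun k => theta_coef tau k u) L) in *.
    set (t := sym_sum (fun k => theta_coef tau k v) L) in *.
    assert (N : forall x y : C, (Cmod (x - y) <= eps -> Cmod y <= Cmod x + eps)%R).
    { intros x y Hxy; replace y with (x + - (x - y)) at 1 by ring.
      eapply Rle_trans; [apply Cmod_triangle|]; rewrite Cmod_opp; lra. }
    assert (N1 := N _ _ G1); assert (N2 := N _ _ G2).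
    replace (f u * g v - f v * g u) with
      (((f u - a * s) * g v + (a * s) * (g v - b * t)) +
       (- ((f v - a * t) * g u) + - ((a * t) * (g u - b * s)))) by ring.
    eapply Rle_trans; [apply Cmod_triangle|].
    eapply Rle_trans; [apply Rplus_le_compat; apply Cmod_triangle|].
    rewrite !Cmod_opp.
    assert (X1 := Rmult_le_compat_Cmod _ (g v) _ _ G1 (Rle_refl _)).
    assert (X2 := Rmult_le_compat_Cmod _ _ _ _ N1 G4).
    assert (X3 := Rmult_le_compat_Cmod _ (g u) _ _ G2 (Rle_refl _)).
    assert (X4 := Rmult_le_compat_Cmod _ _ _ _ N2 G3).
    unfold B; nra. }
  apply Ceq_minus, Cmod_eq_0.
  destruct (Rle_lt_or_eq_dec 0 _ (Cmod_ge_0 (f u * g v - f v * g u))) as [Hpos|]; auto.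
  exfalso; set (m := Cmod (f u * g v - f v * g u)) in *.
  assert (Hm : (0 < Rmin 1 (m / (2 * B)))%R).
  { apply Rmin_glb_lt; [lra|]; apply Rdiv_lt_0_compat; lra. }
  assert (H := Key _ (conj Hm (Rmin_l _ _))).
  assert (H' : (Rmin 1 (m / (2 * B)) * B <= m / (2 * B) * B)%R)
    by (apply Rmult_le_compat_r; [lra|apply Rmin_r]).
  replace (m / (2 * B) * B)%R with (m / 2)%R in H' by (field; lra); lra.
Qed.

(** * Transformations of Theta *)

Definition PIi : C := PI * Ci.

(** Compares exponents exactly, not modulo $2\pi i$; steps that use $e^{\pi i}=-1$ or $e^{2\pi i}=1$
    are made separately. *)
Ltac Cexp_eq :=
  repeat first [rewrite Cexp_pow | rewrite <- Cexp_opp | rewrite <- Cexp_plus];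
  rewrite ?INR_IZR_INZ;
  simpl Z.of_nat; unfold PIi; f_equal; try field; auto.

Lemma e1_1 : e1 1 = 1.
Proof.
  apply (e1_IZR 1).
Qed.

Lemma e1_m1 : e1 (- (1)) = 1.
Proof.
  rewrite <- RtoC_opp; apply (e1_IZR (-1)).
Qed.

Lemma Im_pos_neq_0 (tau : C) : (0 < Im tau)%R -> tau <> 0.
Proof.
  intros H E; rewrite E in H; simpl in H; lra.
Qed.

Lemma Im_S_pos (tau : C) : (0 < Im tau)%R -> (0 < Im (- (1) / tau))%R.
Proof.
  destruct tau as [x y]; simpl; intros H.
  replace (_ + _)%R with (y / (x ^ 2 + y ^ 2))%R by (simpl; field; nra).
  apply Rdiv_lt_0_compat; nra.
Qed.

Lemma Cmod_nome_lt_1 (tau : C) : (0 < Im tau)%R -> (Cmod (e1 tau) < 1)%R.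
Proof.
  intros H; unfold e1; rewrite Cmod_Cexp, <- exp_0; apply exp_increasing.
  destruct tau as [x y]; simpl in *.
  pose proof PI_RGT_0; nra.
Qed.

Lemma Theta_formula (u tau : C) : (0 < Im tau)%R ->
  Theta (u, tau) = Cexp (PIi * tau / 6) * (Cexp (PIi * u) - Cexp (- (PIi * u))) *
    (Eul (e1 tau) (e1 u) * Eul (e1 tau) (e1 (- u))).
Proof.
  intros H; assert (Hq := Cmod_nome_lt_1 tau H).
  assert (E : forall z, Cexp (2 * PI * Ci * z) = e1 z) by (intros z; unfold e1; f_equal; ring).
  rewrite Theta_Eul, !E by (rewrite E; auto).
  replace (Cexp (- (2 * PI * Ci * u))) with (e1 (- u)) by (rewrite <- E; f_equal; ring).
  replace (Cexp (2 * PI * Ci * tau / 12)) with (Cexp (PIi * tau / 6)) by Cexp_eq.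
  reflexivity.
Qed.

Lemma Theta_opp (u tau : C) : (0 < Im tau)%R -> Theta (- u, tau) = - Theta (u, tau).
Proof.
  intros H; rewrite !Theta_formula by auto.
  replace (- - u) with u by ring.
  replace (PIi * - u) with (- (PIi * u)) by ring.
  replace (- - (PIi * u)) with (PIi * u) by ring; ring.
Qed.

Lemma Theta_add_1 (u tau : C) : (0 < Im tau)%R -> Theta (u + 1, tau) = - Theta (u, tau).
Proof.
  intros H; rewrite !Theta_formula by auto.
  replace (- (u + 1)) with (- u + - (1)) by ring.
  rewrite !e1_plus, e1_1, e1_m1.
  replace (PIi * (u + 1)) with (PIi * u + PI * Ci) by (unfold PIi; ring).
  replace (- (PIi * u + PI * Ci)) with (- (PIi * u) + - (PI * Ci)) by ring.
  rewrite !Cexp_plus, (Cexp_opp (PI * Ci)), Cexp_PI.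
  rewrite !Cmult_1_r; field.
Qed.

Lemma Theta_add_tau (u tau : C) : (0 < Im tau)%R ->
  Theta (u + tau, tau) = - e1 (- u - tau / 2) * Theta (u, tau).
Proof.
  intros H; rewrite !Theta_formula by auto.
  assert (Hq := Cmod_nome_lt_1 tau H).
  (* This replaces $E(t)$ by $E(qt)$ and $E(1/(qt))$ by $E(1/t)$, so both sides differ only by
     elementary factors. *)
  rewrite (Eul_step _ (e1 u)), (Eul_step _ (e1 (- (u + tau)))) by auto.
  rewrite <- !e1_plus.
  replace (tau + - (u + tau)) with (- u) by ring.
  replace (tau + u) with (u + tau) by ring.
  set (x := Cexp (PIi * u)); set (y := Cexp (PIi * tau)).
  assert (Hx : x <> 0) by apply Cexp_neq_0; assert (Hy : y <> 0) by apply Cexp_neq_0.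
  replace (e1 (u + tau)) with (x ^ 2 * y ^ 2) by (unfold x, y, e1; Cexp_eq).
  replace (e1 (- u)) with (/ x ^ 2) by (unfold x, y, e1; Cexp_eq).
  replace (e1 (- u - tau / 2)) with (/ (x ^ 2 * y)) by (unfold x, y, e1; Cexp_eq).
  replace (Cexp (PIi * (u + tau))) with (x * y) by (unfold x, y; Cexp_eq).
  replace (Cexp (- (PIi * (u + tau)))) with (/ (x * y)) by (unfold x, y; Cexp_eq).
  replace (Cexp (- (PIi * u))) with (/ x) by (unfold x; Cexp_eq).
  field; auto.
Qed.

Lemma Theta_sub_tau (u tau : C) : (0 < Im tau)%R ->
  Theta (u - tau, tau) = - e1 (u - tau / 2) * Theta (u, tau).
Proof.
  intros H.
  replace u with (u - tau + tau) at 3 by ring.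
  rewrite Theta_add_tau by auto.
  transitivity (e1 (u - tau / 2) * e1 (- (u - tau) - tau / 2) * Theta (u - tau, tau)); [|ring].
  rewrite <- e1_plus.
  replace (u - tau / 2 + (- (u - tau) - tau / 2)) with (RtoC 0) by field.
  rewrite e1_0; ring.
Qed.

Lemma Theta_T (u tau : C) (k : Z) : (0 < Im tau)%R ->
  Theta (u, tau + IZR k) = Cexp (PIi * IZR k / 6) * Theta (u, tau).
Proof.
  intros H; rewrite !Theta_formula by (auto; destruct tau; simpl in *; lra).
  rewrite e1_plus, e1_IZR, Cmult_1_r.
  replace (Cexp (PIi * (tau + IZR k) / 6)) with (Cexp (PIi * IZR k / 6) * Cexp (PIi * tau / 6))
    by Cexp_eq.
  ring.
Qed.

Lemma smooth_Theta (tau : C) : (0 < Im tau)%R -> smooth (fun u => Theta (u, tau)).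
Proof.
  intros H; assert (Hq := Cmod_nome_lt_1 tau H).
  assert (L : forall k : C, smooth (fun u => k * u))
    by (intros; apply smooth_mult; [apply smooth_const|apply smooth_id]).
  apply smooth_ext with (fun u => Cexp (PIi * tau / 6) *
    (Cexp (PIi * u) + - (1) * Cexp (- PIi * u)) * (Eul (e1 tau) (e1 u) * Eul (e1 tau) (e1 (- (1) * u)))).
  - intros u; rewrite Theta_formula by auto.
    replace (- (1) * u) with (- u) by ring.
    replace (- PIi * u) with (- (PIi * u)) by ring; ring.
  - repeat first [apply smooth_mult | apply smooth_plus | apply smooth_Eul; auto |
      apply smooth_e1 | apply smooth_Cexp | apply smooth_const | apply smooth_id].
Qed.

Lemma smooth_comp_scal (f : C -> C) (k : C) : smooth f -> smooth (fun u => f (k * u)).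
Proof.
  intros H r; destruct (H (Cmod k * r)%R) as (M & a & b & c & B & K).
  assert (Hk := Cmod_ge_0 k).
  exists (a + b * Cmod k + c * (Cmod k * Cmod k))%R, a, (b * Cmod k)%R, (c * (Cmod k * Cmod k))%R.
  split; [repeat split; try lra; repeat apply Rmult_le_pos; lra|].
  intros u v w Hu Hv Hw.
  assert (S : forall z, (Cmod z <= r)%R -> (Cmod (k * z) <= Cmod k * r)%R)
    by (intros; rewrite Cmod_mult; apply Rmult_le_compat_l; auto).
  destruct (K _ _ _ (S u Hu) (S v Hv) (S w Hw)) as (K1 & K2 & K3).
  replace (k * u - k * v) with (k * (u - v)) in * by ring.
  replace (k * v - k * w) with (k * (v - w)) in * by ring.
  replace (k * w - k * u) with (k * (w - u)) in * by ring.
  rewrite !Cmod_mult in *.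
  split; [auto|split; [lra|]].
  (* One factor $|k|$ is divided out below; for $k=0$ the left side vanishes instead. *)
  destruct (Ceq_dec k 0) as [->|N].
  - rewrite !Cmult_0_l.
    replace (f 0 * (v - w) + f 0 * (w - u) + f 0 * (u - v)) with (RtoC 0) by ring.
    rewrite Cmod_0; repeat apply Rmult_le_pos; try apply Cmod_ge_0; lra.
  - apply Cmod_gt_0 in N; apply Rmult_le_reg_l with (Cmod k); auto.
    rewrite <- Cmod_mult.
    replace (k * _) with (f (k * u) * (k * (v - w)) + f (k * v) * (k * (w - u)) + f (k * w) * (k * (u - v)))
      by ring.
    eapply Rle_trans; [exact K3|right; ring].
Qed.

Lemma Theta_half_neq_0 (tau : C) : (0 < Im tau)%R -> Theta (/ 2, tau) <> 0.
Proof.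
  intros H; assert (Hq := Cmod_nome_lt_1 tau H).
  rewrite Theta_formula by auto.
  replace (PIi * / 2) with (PI * Ci / 2) by (unfold PIi; field).
  rewrite Cexp_opp, Cexp_PI2.
  replace (e1 (- / 2)) with (- RtoC 1).
  2:{ replace (- / 2) with (/ 2 + - (1)) by field.
      rewrite e1_plus, e1_m1, e1_half; ring. }
  rewrite e1_half.
  (* Euler's identity exhibits an inverse. *)
  assert (N : Eul (e1 tau) (- (1)) <> 0).
  { intros E; assert (L := Eul_level2 _ Hq); rewrite E in L.
    apply C1_nz; rewrite <- L; ring. }
  repeat apply Cmult_neq_0; auto; [apply Cexp_neq_0|].
  intros E; apply (f_equal snd) in E; simpl in E; lra.
Qed.

(* Both sides, as functions of [u], span the same one-dimensional space of
   quasi-periodic functions. *)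
Lemma Theta_S_up_to_const (tau : C) : (0 < Im tau)%R ->
  exists c, forall u, Theta (u / tau, - (1) / tau) =
    c * Cexp (PIi * u ^ 2 / tau) * Theta (u, tau).
Proof.
  intros H; assert (H' := Im_S_pos tau H); assert (Ht := Im_pos_neq_0 tau H).
  set (tau' := - (1) / tau) in *.
  set (f := fun u => Theta (u, tau) * Cexp (PIi * u)).
  set (g := fun u => Theta (/ tau * u, tau') * Cexp (PIi * u + - PIi / tau * (u * u))).
  assert (L : forall k : C, smooth (fun u => k * u))
    by (intros; apply smooth_mult; [apply smooth_const|apply smooth_id]).
  assert (U : forall u v, f u * g v = f v * g u).
  { intros u v; apply quasi_periodic_unique with tau.
    - apply smooth_mult; [apply smooth_Theta|apply smooth_Cexp]; auto.
    - intros z; unfold f; rewrite Theta_add_1 by auto.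
      replace (PIi * (z + 1)) with (PIi * z + PI * Ci) by (unfold PIi; ring).
      rewrite Cexp_plus, Cexp_PI; ring.
    - intros z; unfold f; rewrite Theta_add_tau by auto.
      transitivity (- Theta (z, tau) * (e1 (- z - tau / 2) * Cexp (PIi * (z + tau)))); [ring|].
      replace (e1 (- z - tau / 2) * Cexp (PIi * (z + tau))) with (e1 (- z) * Cexp (PIi * z))
        by (unfold e1; Cexp_eq).
      ring.
    - apply smooth_mult; [apply (smooth_comp_scal (fun u => Theta (u, tau')));
        apply smooth_Theta; auto|].
      apply smooth_Cexp, smooth_plus; auto.
      apply smooth_mult; [apply smooth_const|apply smooth_mult; apply smooth_id].
    - intros z; unfold g.
      (* As $1/\tau=-\tau'$, the inversion exchanges the two lattice shifts: $z\mapsto z+1$ becomes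
         a shift by $-\tau'$, and $z\mapsto z+\tau$ a shift by 1. *)
      replace (/ tau * (z + 1)) with (/ tau * z - tau') by (unfold tau'; field; auto).
      rewrite Theta_sub_tau by auto.
      transitivity (- Theta (/ tau * z, tau') * (e1 (/ tau * z - tau' / 2) *
        Cexp (PIi * (z + 1) + - PIi / tau * ((z + 1) * (z + 1))))); [ring|].
      replace (e1 _ * Cexp _) with (Cexp (PI * Ci) * Cexp (PIi * z + - PIi / tau * (z * z)))
        by (unfold e1, tau'; Cexp_eq).
      rewrite Cexp_PI; ring.
    - intros z; unfold g.
      replace (/ tau * (z + tau)) with (/ tau * z + 1) by (field; auto).
      rewrite Theta_add_1 by auto.
      replace (Cexp (PIi * (z + tau) + _)) with
        (e1 (- z) * Cexp (PIi * z + - PIi / tau * (z * z))) by (unfold e1; Cexp_eq).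
      ring. }
  assert (N : f (/ 2) <> 0)
    by (apply Cmult_neq_0; [apply Theta_half_neq_0; auto|apply Cexp_neq_0]).
  exists (g (/ 2) / f (/ 2)); intros u.
  assert (E : g u = g (/ 2) / f (/ 2) * f u).
  { transitivity (f (/ 2) * g u / f (/ 2)); [field; auto|].
    rewrite <- U; field; auto. }
  unfold g at 1, f at 2 in E.
  replace (/ tau * u) with (u / tau) in E by (field; auto).
  set (c := g (/ 2) / f (/ 2)) in *.
  replace (PIi * u + - PIi / tau * (u * u)) with (PIi * u + - (PIi * u ^ 2 / tau)) in E
    by (field; auto).
  rewrite Cexp_plus, Cexp_opp in E.
  assert (N1 := Cexp_neq_0 (PIi * u)); assert (N2 := Cexp_neq_0 (PIi * u ^ 2 / tau)).
  set (A := Theta (u / tau, tau')) in *; set (x := Cexp (PIi * u)) in *.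
  set (y := Cexp (PIi * u ^ 2 / tau)) in *.
  transitivity (A * (x * / y) * y / x); [field; auto|].
  rewrite E; field; auto.
Qed.

(** At $t=-1$ and $t=\pm q^{1/2}$ the products at $t$ and $1/t$ coincide up to elementary factors,
    so the Euler products assemble to the square of Euler's identity. In the proof $a=q^{1/12}$. *)
Lemma Theta_2_torsion (tau : C) : (0 < Im tau)%R ->
  Theta (/ 2, tau) * Theta (tau / 2, tau) * Theta ((1 + tau) / 2, tau) =
  2 * Cexp (- (PIi * tau / 2)).
Proof.
  intros H; assert (Hq := Cmod_nome_lt_1 tau H).
  rewrite !Theta_formula by auto.
  set (a := Cexp (PIi * tau / 6)).
  assert (Ha : a <> 0) by apply Cexp_neq_0.
  assert (HI := Ci_nz).
  assert (L := Eul_level2 _ Hq).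
  assert (I1 : Cexp (PIi / 2) = Ci) by (rewrite <- Cexp_PI2; reflexivity).
  replace (Cexp (PIi * / 2)) with Ci by (rewrite <- I1; Cexp_eq).
  replace (Cexp (- (PIi * / 2))) with (/ Ci) by (rewrite <- I1; Cexp_eq).
  replace (Cexp (PIi * (tau / 2))) with (a ^ 3) by (unfold a; Cexp_eq).
  replace (Cexp (- (PIi * (tau / 2)))) with (/ a ^ 3) by (unfold a; Cexp_eq).
  replace (Cexp (PIi * ((1 + tau) / 2))) with (Ci * a ^ 3) by (rewrite <- I1; unfold a; Cexp_eq).
  replace (Cexp (- (PIi * ((1 + tau) / 2)))) with (/ (Ci * a ^ 3))
    by (rewrite <- I1; unfold a; Cexp_eq).
  replace (Cexp (- (PIi * tau / 2))) with (/ a ^ 3) by (unfold a; Cexp_eq).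
  replace (e1 (- / 2)) with (- RtoC 1).
  2:{ replace (- / 2) with (/ 2 + - (1)) by field.
      rewrite e1_plus, e1_m1, e1_half; ring. }
  rewrite e1_half.
  replace (e1 (- ((1 + tau) / 2))) with (- e1 (- (tau / 2))).
  2:{ replace (- ((1 + tau) / 2)) with (- (tau / 2) + / 2 + - (1)) by field.
      rewrite !e1_plus, e1_half, e1_m1; ring. }
  replace (e1 ((1 + tau) / 2)) with (- e1 (tau / 2)).
  2:{ replace ((1 + tau) / 2) with (tau / 2 + / 2) by field.
      rewrite e1_plus, e1_half; ring. }
  rewrite (Eul_step _ (e1 (- (tau / 2)))), (Eul_step _ (- e1 (- (tau / 2)))) by auto.
  assert (Hr : e1 tau * e1 (- (tau / 2)) = e1 (tau / 2))
    by (rewrite <- e1_plus; f_equal; field).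
  replace (e1 tau * - e1 (- (tau / 2))) with (- (e1 tau * e1 (- (tau / 2)))) by ring.
  rewrite Hr.
  assert (M := Eul_mul_opp (e1 tau) (e1 (tau / 2)) Hq).
  replace (e1 (tau / 2) ^ 2) with (e1 tau) in M by (unfold e1; Cexp_eq).
  replace (e1 (tau / 2)) with (a ^ 6) in * by (unfold a, e1; Cexp_eq).
  assert (Q : e1 tau = a ^ 12) by (unfold a, e1; Cexp_eq).
  set (q := e1 tau) in *.
  set (X := Eul q (- (1))) in *; set (Y := Eul q (a ^ 6)) in *; set (Z := Eul q (- a ^ 6)) in *.
  rewrite <- M in L.
  assert (I2 : Ci * Ci = - (1)) by (apply injective_projections; simpl; ring).
  transitivity (2 * / a ^ 3 * (X * (1 - a ^ 12) * (Y * Z)) ^ 2).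
  2:{ rewrite <- Q, L; ring. }
  replace (/ (Ci * a ^ 3)) with (- Ci * / a ^ 3).
  2:{ transitivity (- (Ci * Ci) * / (Ci * a ^ 3)); [field; auto|rewrite I2; ring]. }
  replace (/ Ci) with (- Ci).
  2:{ transitivity (- (Ci * Ci) * / Ci); [field; auto|rewrite I2; ring]. }
  (* The inserted factor $-i^2=1$ makes this a formal identity in which $i$ is an indeterminate. *)
  transitivity (- (Ci * Ci) * (2 * / a ^ 3 * (X * (1 - a ^ 12) * (Y * Z)) ^ 2)).
  2:{ rewrite I2; ring. }
  field; auto.
Qed.

Lemma cube_root_of_unity : e1 (/ 3) ^ 2 + e1 (/ 3) + 1 = 0.
Proof.
  set (w := e1 (/ 3)).
  assert (N : w <> 1).
  { unfold w; replace (/ 3) with (RtoC (INR 1 / INR 3)).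
    - apply e1_fraction_neq_1; lia.
    - replace (INR 1) with 1%R by (simpl; ring); replace (INR 3) with 3%R by (simpl; ring).
      rewrite RtoC_div by lra; field. }
  assert (W : w ^ 3 = 1).
  { transitivity (e1 1); [unfold w, e1; Cexp_eq|apply e1_1]. }
  apply Cminus_eq_contra in N.
  transitivity ((w ^ 3 - 1) / (w - 1)); [field; auto|rewrite W; field; auto].
Qed.

(** One point is taken from each pair $\pm u$ of nonzero 3-torsion points. With $r=q^{1/3}$ and $w$
    a cube root of unity, the points other than $1/3$ have $t=r,wr,w^2r$, so their Euler products
    combine by [Eul_mul_cube_roots], and [Eul_level3] evaluates the rest. *)
Lemma Theta_3_torsion (tau : C) : (0 < Im tau)%R ->
  Theta (/ 3, tau) * Theta (tau / 3, tau) * Theta ((1 + tau) / 3, tau) *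
    Theta ((2 + tau) / 3, tau) =
  (Cexp (PIi / 3) - / Cexp (PIi / 3)) * Cexp (- (PIi * tau / 3)).
Proof.
  intros H; assert (Hq := Cmod_nome_lt_1 tau H).
  rewrite !Theta_formula by auto.
  set (a := Cexp (PIi * tau / 6)).
  set (z := Cexp (PIi / 3)).
  assert (Ha : a <> 0) by apply Cexp_neq_0.
  assert (Hz : z <> 0) by apply Cexp_neq_0.
  assert (W := cube_root_of_unity).
  assert (L := Eul_level3 _ _ Hq W).
  assert (M1 := Eul_mul_cube_roots (e1 tau) (e1 (tau / 3)) _ Hq W).
  assert (M2 := Eul_mul_cube_roots (e1 tau) (e1 (tau / 3) ^ 2) _ Hq W).
  replace (Cexp (PIi * / 3)) with z by (unfold z; Cexp_eq).
  replace (Cexp (- (PIi * / 3))) with (/ z) by (unfold z; Cexp_eq).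
  replace (Cexp (PIi * (tau / 3))) with (a ^ 2) by (unfold a; Cexp_eq).
  replace (Cexp (- (PIi * (tau / 3)))) with (/ a ^ 2) by (unfold a; Cexp_eq).
  replace (Cexp (PIi * ((1 + tau) / 3))) with (z * a ^ 2) by (unfold a, z; Cexp_eq).
  replace (Cexp (- (PIi * ((1 + tau) / 3)))) with (/ (z * a ^ 2)) by (unfold a, z; Cexp_eq).
  replace (Cexp (PIi * ((2 + tau) / 3))) with (z ^ 2 * a ^ 2) by (unfold a, z; Cexp_eq).
  replace (Cexp (- (PIi * ((2 + tau) / 3)))) with (/ (z ^ 2 * a ^ 2)) by (unfold a, z; Cexp_eq).
  replace (Cexp (- (PIi * tau / 3))) with (/ a ^ 2) by (unfold a; Cexp_eq).
  set (q := e1 tau) in *.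
  assert (Q : q = a ^ 12) by (unfold a, q, e1; Cexp_eq).
  set (w := e1 (/ 3)) in *.
  assert (Wz : w = z ^ 2) by (unfold w, z, e1; Cexp_eq).
  assert (Z3 : z ^ 3 = - (1)) by (rewrite <- Cexp_PI; unfold z; Cexp_eq).
  assert (W3 : w ^ 3 = 1).
  { rewrite Wz; transitivity (z ^ 3 * z ^ 3); [ring|rewrite Z3; ring]. }
  assert (Wn : w <> 0) by apply e1_neq_0.
  replace (e1 (- / 3)) with (w ^ 2).
  2:{ transitivity (w ^ 3 * / w); [field; auto|].
      rewrite W3, Cmult_1_l; unfold w, e1; Cexp_eq. }
  set (r := e1 (tau / 3)) in *.
  assert (Rn : r <> 0) by apply e1_neq_0.
  assert (R4 : r = a ^ 4) by (unfold r, a, e1; Cexp_eq).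
  replace (e1 (- (tau / 3))) with (/ r) by (unfold r, e1; Cexp_eq).
  replace (e1 ((1 + tau) / 3)) with (w * r) by (unfold w, r, e1; Cexp_eq).
  replace (e1 (- ((1 + tau) / 3))) with (w ^ 2 * / r).
  2:{ transitivity (w ^ 3 * / (w * r)); [field; auto|].
      rewrite W3, Cmult_1_l; unfold w, r, e1; Cexp_eq. }
  replace (e1 ((2 + tau) / 3)) with (w ^ 2 * r) by (unfold w, r, e1; Cexp_eq).
  replace (e1 (- ((2 + tau) / 3))) with (w * / r).
  2:{ transitivity (w ^ 3 * / (w ^ 2 * r)); [field; auto|].
      rewrite W3, Cmult_1_l; unfold w, r, e1; Cexp_eq. }
  assert (Q3 : q = r ^ 3) by (rewrite Q, R4; ring).
  (* Since $q=r^3$, one step turns the arguments with $1/r$ into cube-root multiples of $r^2$. *)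
  rewrite (Eul_step q (/ r)), (Eul_step q (w ^ 2 * / r)), (Eul_step q (w * / r)) by auto.
  replace (q * / r) with (r ^ 2) by (rewrite Q3; field; auto).
  replace (q * (w ^ 2 * / r)) with (w ^ 2 * r ^ 2) by (rewrite Q3; field; auto).
  replace (q * (w * / r)) with (w * r ^ 2) by (rewrite Q3; field; auto).
  rewrite <- Q3 in M1.
  replace ((r ^ 2) ^ 3) with (q ^ 2) in M2 by (rewrite Q3; ring).
  rewrite <- M1, <- M2 in L; clear M1 M2.
  set (E1 := Eul q w) in *; set (E2 := Eul q (w ^ 2)) in *.
  set (F1 := Eul q r) in *; set (F2 := Eul q (w * r)) in *; set (F3 := Eul q (w ^ 2 * r)) in *.
  set (G1 := Eul q (r ^ 2)) in *; set (G2 := Eul q (w * r ^ 2)) in *;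
  set (G3 := Eul q (w ^ 2 * r ^ 2)) in *.
  assert (P1 : (a ^ 2 - / a ^ 2) * (z * a ^ 2 - / (z * a ^ 2)) *
    (z ^ 2 * a ^ 2 - / (z ^ 2 * a ^ 2)) = / a ^ 6 * (1 - q)).
  { transitivity (/ z ^ 3 * / a ^ 6 *
      ((r - 1) * (w * r - 1) * (w ^ 2 * r - 1))); [rewrite Wz, R4; field; auto|].
    rewrite Z3.
    replace ((r - 1) * (w * r - 1) * (w ^ 2 * r - 1)) with
      (w ^ 3 * r ^ 3 - (w ^ 2 + w + 1) * w * r ^ 2 + (w ^ 2 + w + 1) * r - 1) by ring.
    rewrite W, W3, Q3; field; auto. }
  assert (P2 : (1 - r ^ 2) * (1 - w ^ 2 * r ^ 2) * (1 - w * r ^ 2) = 1 - q ^ 2).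
  { transitivity (1 - (w ^ 2 + w + 1) * r ^ 2 + (w ^ 2 + w + 1) * w * r ^ 4 - w ^ 3 * r ^ 6);
      [ring|rewrite W, W3, Q3; ring]. }
  transitivity (a ^ 4 * (z - / z) *
    ((a ^ 2 - / a ^ 2) * (z * a ^ 2 - / (z * a ^ 2)) * (z ^ 2 * a ^ 2 - / (z ^ 2 * a ^ 2))) *
    ((1 - r ^ 2) * (1 - w ^ 2 * r ^ 2) * (1 - w * r ^ 2)) *
    ((F1 * F2 * F3) * (G1 * G2 * G3) * E1 * E2)); [ring|].
  rewrite P1, P2.
  transitivity (a ^ 4 * / a ^ 6 * (z - / z) * ((1 - q) * (1 - q ^ 2) * (F1 * F2 * F3) *
    (G1 * G2 * G3) * E1 * E2)); [ring|].
  rewrite L; field; auto.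
Qed.

(** * The modular group *)

Lemma Ci_sqr : Ci * Ci = - (1).
Proof.
  apply injective_projections; simpl; ring.
Qed.

(** The inversion permutes the 2-torsion points up to sign and translation, so [Theta_2_torsion] at
    $\tau$ and at $-1/\tau$ can be compared. The cross term of $((1+\tau)/2)^2/\tau$ contributes a
    factor $i$, oddness an overall sign, hence $ic^3=-1$. *)
Lemma S_constant_cube (tau c : C) : (0 < Im tau)%R ->
  (forall u, Theta (u / tau, - (1) / tau) = c * Cexp (PIi * u ^ 2 / tau) * Theta (u, tau)) ->
  c ^ 3 = Ci.
Proof.
  intros H Hc; assert (H' := Im_S_pos tau H); assert (Ht := Im_pos_neq_0 tau H).
  assert (P := Theta_2_torsion tau H); assert (P' := Theta_2_torsion _ H').
  assert (h1 := Hc (/ 2)); assert (h2 := Hc (tau / 2)); assert (h3 := Hc ((1 + tau) / 2)).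
  set (tau' := - (1) / tau) in *.
  replace (/ 2 / tau) with (- (tau' / 2)) in h1 by (unfold tau'; field; auto).
  replace (tau / 2 / tau) with (/ 2) in h2 by (field; auto).
  replace ((1 + tau) / 2 / tau) with (- ((1 + tau') / 2) + 1) in h3 by (unfold tau'; field; auto).
  rewrite Theta_opp in h1 by auto; rewrite Theta_add_1, Theta_opp in h3 by auto.
  set (x := Cexp (PIi * (/ 2) ^ 2 / tau)) in *; set (y := Cexp (PIi * (tau / 2) ^ 2 / tau)) in *;
  set (z := Cexp (PIi * ((1 + tau) / 2) ^ 2 / tau)) in *.
  assert (E : - (2 * Cexp (- (PIi * tau' / 2))) =
    c ^ 3 * (x * y * z) * (2 * Cexp (- (PIi * tau / 2)))).
  { rewrite <- P, <- P'.
    transitivity (- Theta (tau' / 2, tau') * Theta (/ 2, tau') *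
      (- - Theta ((1 + tau') / 2, tau'))); [ring|rewrite h1, h2, h3; ring]. }
  replace (x * y * z) with (Cexp (- (PIi * tau' / 2)) * Cexp (PI * Ci / 2) * Cexp (PIi * tau / 2))
    in E by (unfold x, y, z, tau'; Cexp_eq).
  rewrite Cexp_PI2, (Cexp_opp (PIi * tau / 2)) in E.
  assert (N1 := Cexp_neq_0 (- (PIi * tau' / 2))); assert (N2 := Cexp_neq_0 (PIi * tau / 2)).
  set (v := Cexp (- (PIi * tau' / 2))) in *; set (w := Cexp (PIi * tau / 2)) in *.
  assert (HI := Ci_nz).
  transitivity (c ^ 3 * (v * Ci * w) * (2 * / w) / (2 * v * Ci)); [field; auto|].
  rewrite <- E; transitivity (- (1) / Ci); [field; auto|].
  rewrite <- Ci_sqr; field; auto.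
Qed.

(** Same comparison at order 3. The image of $(2+\tau)/3$ needs a translation by $-\tau'$, whose
    multiplier [m] reappears in the product of the four Gaussian factors and cancels. *)
Lemma S_constant_fourth (tau c : C) : (0 < Im tau)%R ->
  (forall u, Theta (u / tau, - (1) / tau) = c * Cexp (PIi * u ^ 2 / tau) * Theta (u, tau)) ->
  c ^ 4 = 1.
Proof.
  intros H Hc; assert (H' := Im_S_pos tau H); assert (Ht := Im_pos_neq_0 tau H).
  assert (P := Theta_3_torsion tau H); assert (P' := Theta_3_torsion _ H').
  assert (h1 := Hc (/ 3)); assert (h2 := Hc (tau / 3)); assert (h3 := Hc ((1 + tau) / 3));
  assert (h4 := Hc ((2 + tau) / 3)).
  set (tau' := - (1) / tau) in *.
  replace (/ 3 / tau) with (- (tau' / 3)) in h1 by (unfold tau'; field; auto).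
  replace (tau / 3 / tau) with (/ 3) in h2 by (field; auto).
  replace ((1 + tau) / 3 / tau) with (- ((2 + tau') / 3) + 1) in h3 by (unfold tau'; field; auto).
  replace ((2 + tau) / 3 / tau) with ((1 + tau') / 3 - tau') in h4 by (unfold tau'; field; auto).
  rewrite Theta_opp in h1 by auto; rewrite Theta_add_1, Theta_opp in h3 by auto.
  rewrite Theta_sub_tau in h4 by auto.
  set (x := Cexp (PIi * (/ 3) ^ 2 / tau)) in *; set (y := Cexp (PIi * (tau / 3) ^ 2 / tau)) in *;
  set (z := Cexp (PIi * ((1 + tau) / 3) ^ 2 / tau)) in *;
  set (t := Cexp (PIi * ((2 + tau) / 3) ^ 2 / tau)) in *.
  set (m := e1 ((1 + tau') / 3 - tau' / 2)) in *.
  set (s := Cexp (PIi / 3)) in *.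
  assert (E : m * ((s - / s) * Cexp (- (PIi * tau' / 3))) =
    c ^ 4 * (x * y * z * t) * ((s - / s) * Cexp (- (PIi * tau / 3)))).
  { rewrite <- P, <- P'.
    transitivity (- Theta (tau' / 3, tau') * Theta (/ 3, tau') *
      (- - Theta ((2 + tau') / 3, tau')) * (- m * Theta ((1 + tau') / 3, tau')));
      [ring|rewrite h1, h2, h3, h4; ring]. }
  replace (x * y * z * t) with (m * Cexp (- (PIi * tau' / 3)) * Cexp (PIi * tau / 3)) in E
    by (unfold x, y, z, t, m, e1, tau'; Cexp_eq).
  rewrite (Cexp_opp (PIi * tau / 3)) in E.
  assert (N1 := Cexp_neq_0 (- (PIi * tau' / 3))); assert (N2 := Cexp_neq_0 (PIi * tau / 3)).
  assert (N3 : m <> 0) by apply e1_neq_0.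
  assert (N4 : s - / s <> 0).
  { assert (N : s <> 0) by apply Cexp_neq_0.
    intros F; assert (W := cube_root_of_unity).
    replace (e1 (/ 3)) with (s ^ 2) in W by (unfold s, e1; Cexp_eq).
    assert (F' : s ^ 2 = 1).
    { transitivity ((s - / s) * s + 1); [field; auto|rewrite F; ring]. }
    rewrite F' in W; apply (f_equal fst) in W; simpl in W; lra. }
  set (d := s - / s) in *.
  set (v := Cexp (- (PIi * tau' / 3))) in *; set (w := Cexp (PIi * tau / 3)) in *.
  transitivity (c ^ 4 * (m * v * w) * (d * / w) / (m * v * d)); [field; auto|].
  rewrite <- E; field; auto.
Qed.

Lemma Theta_S (u tau : C) : (0 < Im tau)%R ->
  Theta (u / tau, - (1) / tau) = - Ci * Cexp (PIi * u ^ 2 / tau) * Theta (u, tau).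
Proof.
  intros H; destruct (Theta_S_up_to_const tau H) as [c Hc].
  replace (- Ci) with c; [apply Hc|].
  assert (C3 := S_constant_cube tau c H Hc); assert (C4 := S_constant_fourth tau c H Hc).
  assert (E : c * Ci = 1) by (rewrite <- C3, <- C4; ring).
  transitivity (- (c * (Ci * Ci))); [rewrite Ci_sqr; ring|].
  rewrite Cmult_assoc, E; ring.
Qed.

(** * Behaviour of [NTheta] under translations and the generators of the modular group *)

Lemma Theta_add_nat (u tau : C) (n : nat) : (0 < Im tau)%R ->
  Theta (u + INR n, tau) = (- (1)) ^ n * Theta (u, tau).
Proof.
  intros H; induction n as [|n IH].
  - simpl INR; rewrite Cplus_0_r; simpl; ring.
  - rewrite S_INR, RtoC_plus, Cplus_assoc, Theta_add_1, IH, Cpow_S by auto; ring.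
Qed.

Lemma Theta_add_nat_tau (u tau : C) (n : nat) : (0 < Im tau)%R ->
  Theta (u + INR n * tau, tau) =
  (- (1)) ^ n * e1 (- (INR n * u) - INR n * INR n * tau / 2) * Theta (u, tau).
Proof.
  intros H; induction n as [|n IH].
  - simpl INR; replace (u + 0 * tau) with u by ring.
    replace (- (0 * u) - 0 * 0 * tau / 2) with (RtoC 0) by field.
    rewrite e1_0; simpl; ring.
  - rewrite S_INR, RtoC_plus.
    replace (u + (INR n + 1) * tau) with (u + INR n * tau + tau) by ring.
    rewrite Theta_add_tau, IH, Cpow_S by auto.
    replace (- ((INR n + 1) * u) - (INR n + 1) * (INR n + 1) * tau / 2) with
      ((- (u + INR n * tau) - tau / 2) + (- (INR n * u) - INR n * INR n * tau / 2)) by field.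
    rewrite (e1_plus (- (u + INR n * tau) - tau / 2)); ring.
Qed.

(** The pullback identity at one point, with $p'$ in the role of the image of $p$. Carrying
    [upper p'] along lets the relations for generators be chained. *)
Definition related (N : nat) (e : C) (p p' : C * C) : Prop :=
  upper p' /\ (pdom (NTheta N) p' <-> pdom (NTheta N) p) /\
  (pdom (NTheta N) p -> pval (NTheta N) p' = e * pval (NTheta N) p).

(** Reduces each generator to its automorphy factors $A$ at $u$ and $B$ at $Nu$; $B\ne0$ makes the
    domains agree. *)
Lemma related_of_factors (N : nat) (e A B u u' tau tau' : C) :
  (0 < Im tau')%R -> B <> 0 ->
  Theta (u', tau') = A * Theta (u, tau) ->
  Theta (INR N * u', tau') = B * Theta (INR N * u, tau) ->
  A ^ (N ^ 2) = e * B -> related N e (u, tau) (u', tau').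
Proof.
  intros H NB E1 E2 E; unfold related, upper, NTheta; cbn [pdom pval fst snd].
  rewrite E1, E2; split; [auto|split].
  - split; intros K L; apply K; [rewrite L; ring|].
    transitivity (B * Theta (INR N * u, tau) / B); [field; auto|rewrite L; field; auto].
  - intros K; rewrite Cpow_mult_l, E; field; auto.
Qed.

Lemma related_trans (N : nat) (e e' : C) (p p' p'' : C * C) :
  related N e p p' -> related N e' p' p'' -> related N (e' * e) p p''.
Proof.
  intros (U & D & V) (U' & D' & V'); split; [auto|split; [tauto|]].
  intros K; rewrite V', V by tauto; ring.
Qed.

Lemma related_1_sym (N : nat) (p p' : C * C) :
  upper p -> related N 1 p p' -> related N 1 p' p.
Proof.
  intros H (U & D & V); split; [auto|split; [tauto|]].
  intros K; rewrite V by tauto; ring.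
Qed.

Lemma sqr_pos_pred (N : nat) : (1 <= N)%nat -> (N ^ 2 = S (N ^ 2 - 1))%nat.
Proof.
  simpl; nia.
Qed.

Lemma related_T (N : nat) (k : Z) (u tau : C) : (1 <= N)%nat -> (0 < Im tau)%R ->
  related N (Cexp (PIi * IZR k / 6) ^ (N ^ 2 - 1)) (u, tau) (u, tau + IZR k).
Proof.
  intros HN H; apply related_of_factors with (Cexp (PIi * IZR k / 6)) (Cexp (PIi * IZR k / 6)).
  - destruct tau; simpl in *; lra.
  - apply Cexp_neq_0.
  - apply Theta_T; auto.
  - apply Theta_T; auto.
  - rewrite (sqr_pos_pred N) at 1 by auto; rewrite Cpow_S; ring.
Qed.

Lemma related_opp (N : nat) (u tau : C) : (1 <= N)%nat -> (0 < Im tau)%R ->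
  related N ((- (1)) ^ (N ^ 2 - 1)) (u, tau) (- u, tau).
Proof.
  intros HN H; apply related_of_factors with (- (1)) (- (1)); auto.
  - intros E; apply (f_equal fst) in E; simpl in E; lra.
  - rewrite Theta_opp by auto; ring.
  - replace (INR N * - u) with (- (INR N * u)) by ring; rewrite Theta_opp by auto; ring.
  - rewrite (sqr_pos_pred N) at 1 by auto; rewrite Cpow_S; ring.
Qed.

Lemma related_S (N : nat) (u tau : C) : (1 <= N)%nat -> (0 < Im tau)%R ->
  related N ((- Ci) ^ (N ^ 2 - 1)) (u, tau) (u / tau, - (1) / tau).
Proof.
  intros HN H; assert (Ht := Im_pos_neq_0 tau H).
  apply related_of_factors with (- Ci * Cexp (PIi * u ^ 2 / tau))
    (- Ci * Cexp (PIi * (INR N * u) ^ 2 / tau)).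
  - apply Im_S_pos; auto.
  - apply Cmult_neq_0; [|apply Cexp_neq_0].
    intros E; apply (f_equal snd) in E; simpl in E; lra.
  - apply Theta_S; auto.
  - replace (INR N * (u / tau)) with (INR N * u / tau) by (field; auto); apply Theta_S; auto.
  (* The Gaussian factor is quadratic in $u$, so its $N^2$-th power is the one at $Nu$; only
     $(-i)^{N^2-1}$ survives. *)
  - rewrite Cpow_mult_l, (sqr_pos_pred N) at 1 by auto; rewrite Cpow_S, Cexp_pow.
    rewrite pow_INR; replace (Cexp ((INR N ^ 2)%R * (PIi * u ^ 2 / tau))) with
      (Cexp (PIi * (INR N * u) ^ 2 / tau)).
    + ring.
    + f_equal; rewrite RtoC_pow; field; auto.
Qed.

(** $N^2\equiv N$ modulo 2; this is why lattice translations act with constant exactly 1. *)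
Lemma opp_1_pow_sqr (N : nat) : (- (1)) ^ (N ^ 2) = (- (1)) ^ N.
Proof.
  assert (T : forall m, (- (1)) ^ (2 * m) = 1).
  { intros m; rewrite Cpow_mult_r; replace ((- (1)) ^ 2) with (RtoC 1) by ring.
    apply Cpow_1_l. }
  destruct (Nat.Even_or_Odd N) as [[m ->]|[m ->]].
  - replace ((2 * m) ^ 2)%nat with (2 * (2 * m * m))%nat by (simpl; ring).
    rewrite !T; reflexivity.
  - replace ((2 * m + 1) ^ 2)%nat with (2 * (2 * m * m + 2 * m) + 1)%nat by (simpl; ring).
    rewrite !Cpow_add_r, !T; reflexivity.
Qed.

Lemma opp_1_pow_neq_0 (n : nat) : (- (1)) ^ n <> 0.
Proof.
  apply Cpow_nz; intros E; apply (f_equal fst) in E; simpl in E; lra.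
Qed.

Lemma related_add_1 (N : nat) (u tau : C) : (0 < Im tau)%R ->
  related N 1 (u, tau) (u + 1, tau).
Proof.
  intros H; apply related_of_factors with (- (1)) ((- (1)) ^ N); auto.
  - apply opp_1_pow_neq_0.
  - rewrite Theta_add_1 by auto; ring.
  - replace (INR N * (u + 1)) with (INR N * u + INR N) by ring; apply Theta_add_nat; auto.
  - rewrite opp_1_pow_sqr; ring.
Qed.

Lemma related_add_tau (N : nat) (u tau : C) : (0 < Im tau)%R ->
  related N 1 (u, tau) (u + tau, tau).
Proof.
  intros H; apply related_of_factors with (- (1) * e1 (- u - tau / 2))
    ((- (1)) ^ N * e1 (- (INR N * (INR N * u)) - INR N * INR N * tau / 2)); auto.
  - apply Cmult_neq_0; [apply opp_1_pow_neq_0|apply e1_neq_0].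
  - rewrite Theta_add_tau by auto; ring.
  - replace (INR N * (u + tau)) with (INR N * u + INR N * tau) by ring.
    apply Theta_add_nat_tau; auto.
  - rewrite Cpow_mult_l, opp_1_pow_sqr; unfold e1; rewrite Cexp_pow, pow_INR, RtoC_pow.
    rewrite Cmult_1_l; do 2 f_equal; field.
Qed.

Lemma related_add_IZR (N : nat) (w tau : C) :
  (0 < Im tau)%R -> (forall u, related N 1 (u, tau) (u + w, tau)) ->
  forall (k : Z) u, related N 1 (u, tau) (u + IZR k * w, tau).
Proof.
  intros H Hw k; pattern k; apply Z.bi_induction; clear k.
  - intros x y ->; tauto.
  - intros u; replace (u + 0 * w) with u by ring.
    split; [exact H|split; [tauto|intros; ring]].
  - intros k.
    assert (E : forall u, u + IZR (Z.succ k) * w = u + IZR k * w + w)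
      by (intros u; rewrite succ_IZR, RtoC_plus; ring).
    split; intros IH u; specialize (IH u); rewrite E in *; rewrite <- (Cmult_1_l 1).
    + apply related_trans with (1 := IH); apply Hw.
    + apply related_trans with (1 := IH); apply related_1_sym; [exact H|apply Hw].
Qed.

Lemma related_lattice (N : nat) (m n : Z) (u tau : C) : (0 < Im tau)%R ->
  related N 1 (u, tau) (u + (IZR m * tau + IZR n), tau).
Proof.
  intros H; rewrite <- (Cmult_1_l 1) at 1.
  replace (u + (IZR m * tau + IZR n)) with (u + IZR m * tau + IZR n * 1) by ring.
  apply related_trans with (u + IZR m * tau, tau); apply related_add_IZR; auto; intros;
    [apply related_add_tau|apply related_add_1]; auto.
Qed.

Lemma lin_neq_0 (c d : R) (tau : C) : (0 < Im tau)%R -> (c <> 0 \/ d <> 0)%R -> c * tau + d <> 0.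
Proof.
  destruct tau as [x y]; simpl; intros H [K|K] E;
    pose proof (f_equal fst E) as E1; pose proof (f_equal snd E) as E2; simpl in E1, E2.
  - apply K; nra.
  - assert (c = 0)%R by nra; subst; apply K; lra.
Qed.

Lemma pow_12_of_pow_12 (z : C) (n : nat) : z ^ 12 = 1 -> (z ^ n) ^ 12 = 1.
Proof.
  intros H; rewrite <- Cpow_mult_r, Nat.mul_comm, Cpow_mult_r, H; apply Cpow_1_l.
Qed.

(** Induction on $|c|$: with $a=kc+r$ and $s=b-kd$, the matrix is $T^k$ times $(0,-1;1,0)$ times
    $(c,d;-r,-s)$. The middle factor is the map of [related_S]. For $c=0$ the matrix is a power of
    $T$ up to sign, and the sign acts as $u\mapsto-u$. *)
Lemma related_SL2 (N : nat) (a b c d : Z) : (1 <= N)%nat -> (a * d - b * c = 1)%Z ->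
  exists e, e ^ 12 = 1 /\ forall u tau, (0 < Im tau)%R ->
    related N e (u, tau) (u / (IZR c * tau + IZR d), (IZR a * tau + IZR b) / (IZR c * tau + IZR d)).
Proof.
  intros HN; revert a b d; pattern c; apply (Z_lt_abs_induction _); clear c.
  intros c IH a b d Hdet.
  assert (T12 : forall k, (Cexp (PIi * IZR k / 6) ^ (N ^ 2 - 1)) ^ 12 = 1).
  { intros k; apply pow_12_of_pow_12.
    transitivity (e1 (IZR k)); [unfold e1; Cexp_eq|apply e1_IZR]. }
  destruct (Z.eq_dec c 0) as [->|Hc].
  - assert (Hd : (a = 1 /\ d = 1 \/ a = -1 /\ d = -1)%Z).
    { assert (a * d = 1)%Z by lia; destruct (Z.mul_eq_1 a d) as [|]; lia. }
    destruct Hd as [[-> ->]|[-> ->]].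
    + exists (Cexp (PIi * IZR b / 6) ^ (N ^ 2 - 1)); split; auto; intros u tau H.
      replace (u / (0 * tau + 1)) with u by field.
      replace ((1 * tau + IZR b) / (0 * tau + 1)) with (tau + IZR b) by field.
      apply related_T; auto.
    + exists ((- (1)) ^ (N ^ 2 - 1) * Cexp (PIi * IZR (- b) / 6) ^ (N ^ 2 - 1)); split.
      * rewrite Cpow_mult_l, T12, pow_12_of_pow_12; ring.
      * intros u tau H.
        replace (u / (0 * tau + -1)) with (- u).
        2:{ replace (RtoC (-1)) with (- (1)) by (rewrite <- RtoC_opp; reflexivity).
            field; intros E; apply (f_equal fst) in E; simpl in E; lra. }
        replace ((-1 * tau + IZR b) / (0 * tau + -1)) with (tau + IZR (- b)).
        2:{ rewrite opp_IZR, RtoC_opp.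
            replace (RtoC (-1)) with (- (1)) by (rewrite <- RtoC_opp; reflexivity).
            field; intros E; apply (f_equal fst) in E; simpl in E; lra. }
        eapply related_trans; [apply related_T; auto|].
        apply related_opp; auto; destruct tau; simpl in *; lra.
  - assert (Ha := Z.div_mod a c Hc).
    set (k := (a / c)%Z) in *; set (r := (a mod c)%Z) in *.
    set (s := (b - k * d)%Z).
    assert (Hr : (Z.abs (- r) < Z.abs c)%Z).
    { unfold r; destruct (Z_lt_le_dec c 0);
      [pose proof (Z.mod_neg_bound a c)|pose proof (Z.mod_pos_bound a c)]; lia. }
    assert (Hdet' : (c * (- s) - d * (- r) = 1)%Z) by (unfold s; nia).
    destruct (IH (- r)%Z Hr c d (- s)%Z Hdet') as (e & He & IHe).
    exists (Cexp (PIi * IZR k / 6) ^ (N ^ 2 - 1) * ((- Ci) ^ (N ^ 2 - 1) * e)); split.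
    + rewrite !Cpow_mult_l, T12, He, pow_12_of_pow_12; [ring|].
      transitivity ((Ci * Ci) ^ 6); [ring|rewrite Ci_sqr; ring].
    + intros u tau H.
      assert (N1 : IZR c * tau + IZR d <> 0).
      { apply lin_neq_0; auto; left; apply not_0_IZR; auto. }
      assert (N2 : IZR (- r) * tau + IZR (- s) <> 0).
      { apply lin_neq_0; auto.
        destruct (Z.eq_dec r 0); [right|left]; apply not_0_IZR; nia. }
      assert (R1 := IHe u tau H); assert (U1 := proj1 R1).
      assert (R2 := related_trans _ _ _ _ _ _ R1 (related_S N _ _ HN U1)).
      assert (R3 := related_trans _ _ _ _ _ _ R2 (related_T N k _ _ HN (proj1 R2))).
      match goal with |- related _ _ _ ?q =>
        match type of R3 with related _ _ _ ?q' => replace q with q'; [exact R3|] end end.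
      assert (Ea : RtoC (IZR a) = IZR c * IZR k + IZR r)
        by (rewrite Ha, plus_IZR, mult_IZR, RtoC_plus, RtoC_mult; reflexivity).
      assert (Es : RtoC (IZR s) = IZR b - IZR k * IZR d)
        by (unfold s; rewrite minus_IZR, mult_IZR, RtoC_minus, RtoC_mult; reflexivity).
      rewrite !opp_IZR, !RtoC_opp, Es in *; rewrite Ea.
      apply injective_projections; cbn [fst snd]; field; auto.
Qed.

(** * The semidirect product and its action *)

Lemma ent_Mmult {m n k : nat} (A : @matrix R m n) (B : @matrix R n k) (i j : nat) :
  (i < m)%nat -> (j < k)%nat ->
  ent (Mmult (T := R_Ring) A B) i j = sum_n (fun l => ent A i l * ent B l j)%R (pred n).
Proof.
  intros Hi Hj; unfold ent, Mmult; rewrite coeff_mat_bij by auto; reflexivity.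
Qed.

Lemma ent_Mmult_2 {m k : nat} (A : @matrix R m 2) (B : @matrix R 2 k) (i j : nat) :
  (i < m)%nat -> (j < k)%nat ->
  ent (Mmult (T := R_Ring) A B) i j = (ent A i 0 * ent B 0 j + ent A i 1 * ent B 1 j)%R.
Proof.
  intros Hi Hj; rewrite ent_Mmult by auto; simpl pred.
  rewrite sum_Sn, sum_O; reflexivity.
Qed.

Lemma ent_Mplus {m n : nat} (A B : @matrix R m n) (i j : nat) :
  (i < m)%nat -> (j < n)%nat ->
  ent (Mplus A B : @matrix R m n) i j = (ent A i j + ent B i j)%R.
Proof.
  intros Hi Hj; unfold ent, Mplus; rewrite coeff_mat_bij by auto; reflexivity.
Qed.

(** The row vectors match because $(x+yA^{-1})AB=xAB+(\det A)\,yB$ when [inv2] is the adjugate, that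
    is for $\det A=1$; [X1] and [X2] are its two entries. *)
Lemma act_gmul (g h : Gt) (p : C * C) :
  det2 (snd g) = 1%R -> det2 (snd h) = 1%R -> upper p ->
  act (gmul g h) p = act g (act h p).
Proof.
  destruct g as [x A], h as [y B], p as [u tau]; unfold upper; cbn [snd]; intros HA HB H.
  unfold act, gmul, rho; cbn [fst snd].
  rewrite !ent_Mmult_2 by lia.
  rewrite !ent_Mplus, !ent_Mmult_2 by lia.
  unfold inv2; rewrite HA.
  change (ent (mat2 ?a ?b ?c ?d) 0 0) with a; change (ent (mat2 ?a ?b ?c ?d) 0 1) with b;
  change (ent (mat2 ?a ?b ?c ?d) 1 0) with c; change (ent (mat2 ?a ?b ?c ?d) 1 1) with d.
  unfold det2 in HA, HB.
  set (a := ent A 0 0) in *; set (b := ent A 0 1) in *; set (c := ent A 1 0) in *;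
  set (d := ent A 1 1) in *.
  set (a' := ent B 0 0) in *; set (b' := ent B 0 1) in *; set (c' := ent B 1 0) in *;
  set (d' := ent B 1 1) in *.
  set (x1 := ent x 0 0); set (x2 := ent x 0 1); set (y1 := ent y 0 0); set (y2 := ent y 0 1).
  assert (N1 : c' * tau + d' <> 0).
  { apply lin_neq_0; auto; destruct (Req_dec c' 0) as [E|]; [right|left]; auto.
    intros E'; rewrite E, E' in HB; lra. }
  assert (N2 : (c * a' + d * c') * tau + (c * b' + d * d') <> 0).
  { rewrite <- !RtoC_mult, <- !RtoC_plus; apply lin_neq_0; auto.
    destruct (Req_dec (c * a' + d * c') 0) as [E|]; [right|left]; auto; intros E'.
    assert ((a * d - b * c) * (a' * d' - b' * c') = 1)%R by (rewrite HA, HB; ring).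
    assert ((a * d - b * c) * (a' * d' - b' * c') =
      (a * a' + b * c') * (c * b' + d * d') - (a * b' + b * d') * (c * a' + d * c'))%R by ring.
    rewrite E, E' in *; lra. }
  assert (X1 : ((x1 + (y1 * (d / 1) + y2 * (- c / 1))) * (a * a' + b * c') +
      (x2 + (y1 * (- b / 1) + y2 * (a / 1))) * (c * a' + d * c') =
    x1 * (a * a' + b * c') + x2 * (c * a' + d * c') + (a * d - b * c) * (y1 * a' + y2 * c'))%R)
    by field.
  assert (X2 : ((x1 + (y1 * (d / 1) + y2 * (- c / 1))) * (a * b' + b * d') +
      (x2 + (y1 * (- b / 1) + y2 * (a / 1))) * (c * b' + d * d') =
    x1 * (a * b' + b * d') + x2 * (c * b' + d * d') + (a * d - b * c) * (y1 * b' + y2 * d'))%R)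
    by field.
  rewrite HA, Rmult_1_l in X1, X2; rewrite X1, X2.
  rewrite !RtoC_plus, !RtoC_mult, !RtoC_plus, !RtoC_mult.
  assert (N3 : c * (a' * tau + b') + d * (c' * tau + d') <> 0).
  { intros E; apply N2; rewrite <- E; ring. }
  apply injective_projections; cbn [fst snd]; field; auto.
Qed.

Lemma ent_row2_I2 (x1 x2 : R) (j : nat) : (j < 2)%nat ->
  ent (Mmult (T := R_Ring) (row2 x1 x2) I2) 0 j = ent (row2 x1 x2) 0 j.
Proof.
  intros Hj; rewrite ent_Mmult_2 by lia.
  destruct j as [|[|j]]; [| |lia]; unfold ent, coeff_mat; simpl; ring.
Qed.

Lemma related_Gammat (N : nat) (g : Gt) : (1 <= N)%nat -> Gammat g ->
  exists e, e ^ 12 = 1 /\ forall p, upper p -> related N e p (act g p).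
Proof.
  destruct g as [x A]; unfold Gammat; cbn [fst snd]; intros HN (Hx & HA & Hdet).
  destruct (Hx 0 0)%nat as [x1 E1], (Hx 0 1)%nat as [x2 E2].
  destruct (HA 0 0)%nat as [a Ea], (HA 0 1)%nat as [b Eb],
    (HA 1 0)%nat as [c Ec], (HA 1 1)%nat as [d Ed].
  assert (D : (a * d - b * c = 1)%Z).
  { apply eq_IZR; rewrite minus_IZR, !mult_IZR; unfold det2 in Hdet; congruence. }
  destruct (related_SL2 N a b c d HN D) as (e & He & HR).
  exists e; split; auto; intros [u tau] H; unfold upper in H; cbn [snd] in H.
  unfold act, rho; rewrite !ent_Mmult_2 by lia.
  rewrite E1, E2, Ea, Eb, Ec, Ed.
  rewrite <- !mult_IZR, <- !plus_IZR, <- (Cmult_1_r e).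
  (* The action translates first, by the integral row $xA$, and only then applies $A$; the
     translation contributes 1. *)
  eapply related_trans; [apply related_lattice; auto|apply HR; auto].
Qed.

(** For real $u$ one has $|t|=1$, so no Euler factor vanishes and only $t^{1/2}-t^{-1/2}$ remains,
    which is zero at integers alone. *)
Lemma Theta_rational_neq_0 (n : nat) (tau : C) : (1 <= n)%nat -> (0 < Im tau)%R ->
  Theta (RtoC (INR 1 / INR (S n))%R, tau) <> 0.
Proof.
  intros Hn H; assert (Hq := Cmod_nome_lt_1 tau H).
  set (x := (INR 1 / INR (S n))%R).
  assert (E : forall y : R, Eul (e1 tau) (e1 y) <> 0).
  { intros y; apply Eul_neq_0; auto; intros [|k] Hk F; [lia|].
    assert (L := Cmod_pow_lt_1 (e1 tau) k Hq).
    apply Ceq_minus in F; apply (f_equal Cmod) in F.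
    rewrite Cmod_mult, Cmod_e1_R, Cmod_1 in F; lra. }
  rewrite Theta_formula by auto; rewrite <- RtoC_opp.
  repeat apply Cmult_neq_0; auto; [apply Cexp_neq_0|].
  rewrite Cexp_opp; set (y := Cexp (PIi * x)); assert (Ny : y <> 0) by apply Cexp_neq_0.
  intros F; apply (e1_fraction_neq_1 1 n); [lia|]; fold x.
  replace (e1 x) with (y ^ 2) by (unfold y, e1; Cexp_eq).
  transitivity ((y - / y) * y + 1); [field; auto|rewrite F; ring].
Qed.

Lemma NTheta_nonzero_point (N : nat) : (1 <= N)%nat ->
  exists p, upper p /\ pdom (NTheta N) p /\ pval (NTheta N) p <> 0.
Proof.
  intros HN.
  assert (H : (0 < Im Ci)%R) by (simpl; lra).
  (* The point is $u=1/(2N)$: the denominator is evaluated at $Nu=1/2$, and $u$ is not an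
     integer. *)
  set (n := (2 * N - 1)%nat).
  exists (RtoC (INR 1 / INR (S n))%R, Ci).
  assert (D : Theta (INR N * (INR 1 / INR (S n))%R, Ci) <> 0).
  { replace (INR N * (INR 1 / INR (S n))%R) with (/ RtoC 2); [apply Theta_half_neq_0; auto|].
    rewrite <- RtoC_mult, <- RtoC_inv by lra; f_equal.
    replace (S n) with (2 * N)%nat by (unfold n; lia).
    assert (1 <= INR N)%R by (apply (le_INR 1); auto).
    rewrite mult_INR; simpl (INR 1); simpl (INR 2); field; lra. }
  unfold NTheta; cbn [pdom pval fst snd].
  split; [exact H|split; [exact D|]].
  apply Cmult_neq_0; [apply Cpow_nz, Theta_rational_neq_0; auto; unfold n; lia|].
  intros E; apply C1_nz; rewrite <- (Cinv_r _ D), E; ring.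
Qed.

Lemma related_unique (N : nat) (e e' : C) (f : C * C -> C * C) : (1 <= N)%nat ->
  (forall p, upper p -> related N e p (f p)) ->
  (forall p, upper p -> related N e' p (f p)) -> e = e'.
Proof.
  intros HN H H'.
  destruct (NTheta_nonzero_point N HN) as (p & U & D & V).
  destruct (H p U) as (_ & _ & K), (H' p U) as (_ & _ & K').
  specialize (K D); specialize (K' D); rewrite K in K'.
  set (v := pval (NTheta N) p) in *.
  transitivity (e * v / v); [field; auto|rewrite K'; field; auto].
Qed.

Theorem theorem3p3 (N : nat) (hN : (1 <= N)%nat) :
  exists eps : Gt -> C,
    is_mu12_character eps /\
    (forall g : Gt, Gammat g ->
       pfun_eq (pullback g (NTheta N)) (pscale (eps g) (NTheta N))) /\
    (forall x1 x2 : Z, eps (row2 (IZR x1) (IZR x2), I2) = 1) /\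
    eps (row2 0 0, Tmat) = Cexp (2 * PI * Ci * (INR (N ^ 2) - 1) / 12) /\
    eps (row2 0 0, Smat) = Ci ^ (N ^ 2 - 1).
Proof.
  set (P := fun (g : Gt) (e : C) => forall p, upper p -> related N e p (act g p)).
  (* By [related_unique] an admissible constant for $g$ is unique, so every claim about [eps]
     reduces to exhibiting one admissible constant; for a product this is the composite of two
     relations. *)
  set (eps := fun g => epsilon (inhabits (RtoC 0)) (P g)).
  assert (Heps : forall g e, P g e -> eps g = e).
  { intros g e He; apply (related_unique N _ _ (act g) hN); [|exact He].
    unfold eps; apply epsilon_spec; exists e; exact He. }
  assert (HG : forall g, Gammat g -> eps g ^ 12 = 1 /\ P g (eps g)).
  { intros g Hg; destruct (related_Gammat N g hN Hg) as (e & He & K).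
    rewrite (Heps g e K); split; auto. }
  exists eps; split; [split|split; [|split; [|split]]].
  - intros g Hg; apply HG; auto.
  - intros g h Hg Hh; apply Heps; intros p Hp.
    destruct (HG g Hg) as [_ Kg], (HG h Hh) as [_ Kh].
    destruct Hg as (_ & _ & Dg), Hh as (_ & _ & Dh).
    rewrite act_gmul by auto.
    assert (R1 := Kh p Hp).
    apply related_trans with (1 := R1); apply Kg, R1.
  - intros g Hg p Hp; destruct (proj2 (HG g Hg) p Hp) as (_ & D & V).
    unfold pullback, pscale; cbn [pdom pval]; split; [exact D|tauto].
  - intros x1 x2; apply Heps; intros [u tau] H; unfold upper in H; cbn [snd] in H.
    unfold act, rho; rewrite !ent_row2_I2 by lia.
    unfold ent, coeff_mat; simpl.
    replace ((u + (IZR x1 * tau + IZR x2)) / (0 * tau + 1)) with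
      (u + (IZR x1 * tau + IZR x2)) by field.
    replace ((1 * tau + 0) / (0 * tau + 1)) with tau by field.
    apply related_lattice; auto.
  - apply Heps; intros [u tau] H; unfold upper in H; cbn [snd] in H.
    set (n2 := (N ^ 2)%nat).
    unfold act, rho; rewrite !ent_Mmult_2 by lia; unfold ent, coeff_mat; simpl; subst n2.
    rewrite !Rmult_0_l, !Rplus_0_l.
    replace ((u + (0 * tau + 0)) / (0 * tau + 1)) with u by field.
    replace ((1 * tau + 1) / (0 * tau + 1)) with (tau + 1) by field.
    replace (Cexp _) with (Cexp (PIi * 1 / 6) ^ (N ^ 2 - 1)); [apply (related_T N 1); auto|].
    rewrite Cexp_pow, minus_INR by (simpl; nia).
    rewrite RtoC_minus; unfold PIi; f_equal; simpl (INR 1); field.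
  - apply Heps; intros [u tau] H; unfold upper in H; cbn [snd] in H.
    assert (Ht := Im_pos_neq_0 tau H).
    set (n2 := (N ^ 2)%nat).
    unfold act, rho; rewrite !ent_Mmult_2 by lia; unfold ent, coeff_mat; simpl; subst n2.
    rewrite !Rmult_0_l, !Rplus_0_l.
    assert (M1 : RtoC (-1) = - (1)) by (rewrite <- RtoC_opp; reflexivity).
    rewrite M1.
    replace ((u + (0 * tau + 0)) / (- (1) * tau + 0)) with (- (u / tau)) by (field; auto).
    replace ((0 * tau + 1) / (- (1) * tau + 0)) with (- (1) / tau) by (field; auto).
    (* [Smat] sends $(u,\tau)$ to $(-u/\tau,-1/\tau)$, the map of [related_S] followed by
       $u\mapsto-u$; this turns $-i$ into $i$. *)
    replace (Ci ^ (N ^ 2 - 1)) with ((- (1)) ^ (N ^ 2 - 1) * (- Ci) ^ (N ^ 2 - 1)).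
    + eapply related_trans; [apply related_S; auto|apply related_opp; auto; apply Im_S_pos; auto].
    + rewrite <- Cpow_mult_l; f_equal; ring.
Qed.
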